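(* Let $r,p,\tau,\alpha,\beta$ be as in the context, and consider the equation $$(E)\qquad (r(t)\Phi(y'))'=p(t)\Phi(y(\tau(t))).$$ Assume that $\int_a^\infty r^{1-\beta}(s)\,ds<\infty$, and put $R_C(t)=\int_t^\infty r^{1-\beta}(s)\,ds$, $Q=1/R_C$, $$\tau_C=Q\circ\tau\circ Q^{-1},\qquad p_C=(R_C^2\,p\,r^{\beta-1})\circ Q^{-1},\qquad q_C=(R_C\,p\,r^{\beta-2})^{\beta-1}.$$ Assume that $p_C\in\mathcal{RV}(\alpha-2)$ and $\lim_{t\to\infty}L_{p_C}(t)=0$. Let $\tau\in C^1$, $\tau'>0$, $\tau(t)\le t$, and $$\limsup_{t\to\infty}\frac{t}{\tau_C(t)}<\infty,\qquad\tau_C'\in\mathcal{SV},\qquad\limsup_{t\to\infty}\tau_C'(t)<\infty.$$ Then for any $y\in\mathcal{IS}$ one has $y\circ Q^{-1}\in\mathcal{NSV}$ and the following hold. (i) If $\int_a^\infty q_C(s)\,ds=\infty$, then $$y(t)=\exp\left\{\int_a^t(1+o(1))(\beta-1)^{\beta-1}q_C(s)\,ds\right\}\quad\text{as }t\to\infty,$$ and $y\in\mathcal{IS}_{\infty,\infty}$. (ii) If $\int_a^\infty q_C(s)\,ds<\infty$, then $$y(t)=N\exp\left\{-\int_t^\infty(1+o(1))(\beta-1)^{\beta-1}q_C(s)\,ds\right\}\quad\text{as }t\to\infty,$$ and $y\in\mathcal{IS}_{B,\infty}$, with $\lim_{t\to\infty}y(t)=N\in(0,\infty)$. In addition, $|y\circ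 Q^{-1}-N|\in\mathcal{SV}$ and $$\frac{R_C^\alpha(t)p(t)r^{\beta-1}(t)}{\Phi(y(t)-N)}=o(1)\quad\text{as }t\to\infty.$$
   Context: Setting. $a>0$; $r,p:[a,\infty)\to(0,\infty)$ are continuous; $\alpha>1$, $\Phi(u)=|u|^{\alpha-1}\operatorname{sgn}u$; $\beta$ is the conjugate number of $\alpha$, $1/\alpha+1/\beta=1$. The delay $\tau$ is a function on $[a,\infty)$. $Q^{-1}$ denotes the inverse function of $Q$; $\tau_C$ is considered for arguments so large that it is defined (i.e. $\tau\ge a$ at the relevant point). Solutions. A solution $y$ of (E) is a $C^1$ function on an interval $I\subseteq[a,\infty)$ with $r\Phi(y')\in C^1(I)$ satisfying the equation. $\mathcal S$ is the set of $y$ that are positive solutions of (E) for all large $t$. $\mathcal{IS}=\{y\in\mathcal S: y'(t)>0\text{ for large }t\}$. Quasiderivative: $y^{[1]}=r\Phi(y')$. For $u,v\in\{B,\infty\}$, $\mathcal{IS}_{u,v}=\{y\in\mathcal{IS}:\lim_{t\to\infty}y(t)=u,\ \lim_{t\to\infty}y^{[1]}(t)=v\}$, where the value $B$ means that the corresponding limit is a finite nonzero real number. Regular variation. A measurable $f:[a,\infty)\to(0,\infty)$ (positivity and all statements for large $t$ suffice) is in $\mathcal{RV}(\vartheta)$, $\vartheta\in\mathbb R$, if $\lim_{t\to\infty}f(\lambda t)/f(t)=\lambda^\vartheta$ for every $\lambda>0$; $\mathcal{SV}=\mathcal{RV}(0)$. For $f\in\mathcal{RV}(\vartheta)$, $L_f(t)=f(t)/t^\vartheta$;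 thus $L_{p_C}(s)=s^{2-\alpha}p_C(s)$. $f\in\mathcal{NSV}$ (normalized slowly varying) if $f(t)=C\exp\{\int_{t_0}^t\psi(s)/s\,ds\}$ for large $t$, with $C\in(0,\infty)$ and $\psi$ measurable, $\psi(t)\to0$; for $f\in C^1$ this is equivalent to $tf'(t)/f(t)\to0$. Conventions. Inside an integral in the variable $s$, $1+o(1)$ stands for $1+\varepsilon(s)$ for some function $\varepsilon$ with $\varepsilon(s)\to0$ as $s\to\infty$; the formulas hold for all large $t$. *)

(* Defs.v *)
From HB Require Import structures.
From mathcomp Require Import all_boot all_order all_algebra.
From mathcomp Require Import all_classical all_reals all_analysis.

Set Implicit Arguments.
Unset Strict Implicit.
Unset Printing Implicit Defensive.

Import Order.TTheory GRing.Theory Num.Theory.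
Import numFieldNormedType.Exports.

Local Open Scope classical_set_scope.
Local Open Scope ring_scope.

(* Functions given on [a, +oo) are encoded as total functions R -> R, and only
   their values on [a, +oo) matter.  Measurability is Borel measurability. *)

(* The derivative of f relative to I: one-sided at an endpoint belonging to I
   and equal to derive1 f x at an interior point x. *)
Definition derivable_within {R : realType} (I : set R) (f : R -> R) (x : R) :=
  cvg ((f z - f x) / (z - x) @[z --> within I x^']).

Definition derive_within {R : realType} (I : set R) (f : R -> R) (x : R) : R :=
  lim ((f z - f x) / (z - x) @[z --> within I x^']).

Definition C1_on {R : realType} (I : set R) (f : R -> R) :=
  (forall x, I x -> derivable_within I f x) /\
  {within I, continuous (derive_within I f)}.

Definition Phi {R : realType} (alpha u : R) : R :=
  `|u| `^ (alpha - 1) * Num.sg u.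

(* y^[1] = r Phi(y'), where dy stands for y'. *)
Definition quasi {R : realType} (alpha : R) (r dy : R -> R) (t : R) : R :=
  r t * Phi alpha (dy t).

Definition solution_on {R : realType} (alpha : R) (r p tau : R -> R)
    (I : set R) (y : R -> R) :=
  let y1 := quasi alpha r (derive_within I y) in
  [/\ C1_on I y, C1_on I y1 &
      forall t, I t -> derive_within I y1 t = p t * Phi alpha (y (tau t))].

Definition classS {R : realType} (a alpha : R) (r p tau y : R -> R) :=
  exists t0, [/\ a <= t0, solution_on alpha r p tau `[t0, +oo[ y &
                 forall t, t0 <= t -> 0 < y t].

Definition classIS {R : realType} (a alpha : R) (r p tau y : R -> R) :=
  classS a alpha r p tau y /\ \forall t \near +oo, 0 < derive1 y t.

(* The two values B and oo of the indices in IS_{u,v}. *)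
Inductive limit_kind := LimB | LimInfty.

Definition has_limit_kind {R : realType} (k : limit_kind) (f : R -> R) :=
  match k with
  | LimB => exists l : R, l != 0 /\ f t @[t --> +oo] --> l
  | LimInfty => f t @[t --> +oo] --> +oo
  end.

Definition classISuv {R : realType} (u v : limit_kind) (a alpha : R)
    (r p tau y : R -> R) :=
  [/\ classIS a alpha r p tau y, has_limit_kind u y &
      has_limit_kind v (quasi alpha r (derive1 y))].

Definition RV {R : realType} (theta : R) (f : R -> R) :=
  (exists t0 : R, measurable_fun `[t0, +oo[ f /\
                  forall t, t0 <= t -> 0 < f t) /\
  forall lambda : R, 0 < lambda ->
    f (lambda * t) / f t @[t --> +oo] --> lambda `^ theta.

Definition SV {R : realType} (f : R -> R) := RV 0 f.

Definition slow_part {R : realType} (theta : R) (f : R -> R) (t : R) : R :=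
  f t / t `^ theta.

Definition NSV {R : realType} (f : R -> R) :=
  exists (C t0 : R) (psi : R -> R),
    [/\ 0 < C, 0 < t0, measurable_fun `[t0, +oo[ psi,
        psi t @[t --> +oo] --> (0 : R) &
        \forall t \near +oo,
          lebesgue_measure.-integrable `[t0, t] (fun s => (psi s / s)%:E) /\
          f t = C * expR (\int[lebesgue_measure]_(s in `[t0, t]) (psi s / s))].

Section transformation.
Context {R : realType} (a alpha beta : R) (r p tau : R -> R).

Definition R_C (t : R) : R := \int[lebesgue_measure]_(s in `[t, +oo[) (r s `^ (1 - beta)).

Definition Q (t : R) : R := (R_C t)^-1.

(* The inverse of Q : [a, +oo) -> Q([a, +oo)). *)
Definition Qinv : R -> R := pinv `[a, +oo[ Q.

Definition tau_C : R -> R := Q \o tau \o Qinv.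

Definition p_C : R -> R :=
  (fun t => R_C t ^+ 2 * p t * r t `^ (beta - 1)) \o Qinv.

Definition q_C (t : R) : R := (R_C t * p t * r t `^ (beta - 2)) `^ (beta - 1).

(* (1 + eps(s)) (beta - 1)^(beta - 1) q_C(s) *)
Definition q_C_perturbed (eps : R -> R) (s : R) : R :=
  (1 + eps s) * (beta - 1) `^ (beta - 1) * q_C s.

End transformation.

(* Main.v *)
Require Import Defs.
From HB Require Import structures.
From mathcomp Require Import all_boot all_order all_algebra.
From mathcomp Require Import all_classical all_reals all_analysis.
From mathcomp Require Import measurable_realfun ring lra.

(* In the variable s = Q(t) the equation becomes
   (s^(2 alpha - 2) Phi(w'))' = p_C(s) Phi(w(tau_C(s))) for w = y o Q^-1.  With
   v = s^(2 alpha - 2) Phi(w') and k = beta - 1 = 1/(alpha - 1) this is the system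
   w' = v^k / s^2, v' = p_C w(tau_C)^(alpha - 1).  As w increases and p_C(s) is
   o(s^(alpha - 2)), v is o((s w)^(alpha - 1)), that is s w'/w -> 0.  Hence
   w(tau_C(s)) ~ w(s), so v' is regularly varying of index alpha - 2 and
   Karamata's theorem gives v ~ s v'/(alpha - 1), which reads
   y'/y ~ (beta - 1)^(beta - 1) q_C; (i) and (ii) follow by integration.  If w
   tends to N, then w' is regularly varying of index -1, so N - w is slowly
   varying and s w'(s) = o(N - w(s)), which is the last claim. *)

Set Implicit Arguments.
Unset Strict Implicit.
Unset Printing Implicit Defensive.

Import Order.TTheory GRing.Theory Num.Theory.
Import numFieldNormedType.Exports.

Local Open Scope classical_set_scope.
Local Open Scope ring_scope.

(** * Derivatives and limits at infinity *)

Section real_lemmas.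
Context {R : realType}.
Implicit Types (f g df : R -> R) (a b c d e x y z l s t : R).

(** The comparisons of w, v and N - w are obtained by differentiating a suitable difference and
    checking a sign. Karamata's theorem needs more: the limits in [RV] are pointwise in the scaling
    factor, while the behaviour of s v'/v at the single point s is wanted. The proof averages s v'/v
    over [s, e s] on the logarithmic scale. The average is exactly ln(v(e s)/v(s)), whose limit is
    the index of v, and dominated convergence carries this limit from the average back to the point
    s.

    The function eps in the integral formulas is not estimated. It is defined by an explicit formula
    that makes (1 + eps) (beta - 1)^(beta - 1) q_C equal to y'/y at every t from some point on, so
    the asymptotic content is only that eps tends to 0, and both formulas become the fundamental
    theorem of calculus for ln y.

    The delay costs nothing because w is increasing and slowly varying: a bound c s <= tau_C(s) <= s
    confines w(tau_C(s)) between w(c s) and w(s). *)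

Lemma is_derive1_continuous f x d : is_derive x 1 f d -> {for x, continuous f}.
Proof.
by move=> [fx _]; apply/differentiable_continuous/derivable1_diffP.
Qed.

Lemma MVT_is_derive f df x y : x <= y ->
  (forall z, x <= z <= y -> is_derive z 1 f (df z)) ->
  exists2 c, x <= c <= y & f y - f x = df c * (y - x).
Proof.
move=> xy fd.
have [||c] := @MVT_segment R f df x y xy.
- by move=> z /[!in_itv]/= /andP[xz zy]; apply: fd; rewrite !ltW.
- apply: continuous_in_subspaceT => z; rewrite inE/= in_itv/= => xzy.
  exact: is_derive1_continuous (fd _ xzy).
- by rewrite in_itv/=; exists c.
Qed.

Lemma is_derive_ge0_le f df a x y :
  (forall z, a <= z -> is_derive z 1 f (df z)) ->
  (forall z, a <= z -> 0 <= df z) -> a <= x -> x <= y -> f x <= f y.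
Proof.
move=> fd df0 ax xy; rewrite -subr_ge0.
have [z /andP[xz zy]|c /andP[xc _] ->] := @MVT_is_derive f df x y xy.
  exact/fd/(le_trans ax).
by rewrite mulr_ge0// ?subr_ge0// df0// (le_trans ax).
Qed.

Lemma is_derive_gt0_lt f df a x y :
  (forall z, a <= z -> is_derive z 1 f (df z)) ->
  (forall z, a <= z -> 0 < df z) -> a <= x -> x < y -> f x < f y.
Proof.
move=> fd df0 ax xy; rewrite -subr_gt0.
have [z /andP[xz zy]|c /andP[xc _] ->] := @MVT_is_derive f df x y (ltW xy).
  exact/fd/(le_trans ax).
by rewrite mulr_gt0// ?subr_gt0// df0// (le_trans ax).
Qed.

Lemma is_derive_mull c x : is_derive x 1 (fun x => c * x) c.
Proof. by have := is_deriveZ c (is_derive_id x 1); rewrite /GRing.scale/= mulr1. Qed.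

Lemma is_derive_comp_scale f c s d : is_derive (c * s) 1 f d ->
  is_derive s 1 (fun x => f (c * x)) (c * d).
Proof.
by move=> fd; rewrite mulrC; exact: is_derive1_comp fd (is_derive_mull c s).
Qed.

Lemma near_pinftyS a (P : R -> Prop) :
  (forall t, a <= t -> P t) -> \forall t \near +oo, P t.
Proof.
by move=> h; near=> t; apply: h; near: t; apply: nbhs_pinfty_ge; rewrite num_real.
Unshelve. all: by end_near. Qed.

Lemma near_pinftyP (P : R -> Prop) :
  (\forall t \near +oo, P t) ->
  forall a, exists2 b, a <= b & forall t, b <= t -> P t.
Proof.
move=> [M [_ MP]] a; exists (Num.max a (M + 1)); first by rewrite le_max lexx.
move=> t; rewrite ge_max => /andP[_ h]; apply: MP.
by rewrite (lt_le_trans _ h)// ltrDl.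
Qed.

Lemma near_eq_cvgy f g l : (\forall t \near +oo, f t = g t) ->
  g t @[t --> +oo] --> l -> f t @[t --> +oo] --> l.
Proof.
by move=> fg; apply: cvg_trans; apply: near_eq_cvg; apply: filterS fg.
Qed.

Lemma cvg_scaley (c : R) : 0 < c -> c * t @[t --> +oo] --> +oo.
Proof. by move=> c0; apply: gt0_cvgMry => //; exact: cvg_id. Qed.

Lemma powR_sub1 x e : 0 < x -> x `^ (e - 1) = x `^ e / x.
Proof.
by move=> x0; rewrite powRB ?lt0r_neq0 ?implybT// powRr1// ltW.
Qed.

Lemma powR_invr x e : 0 <= x -> x^-1 `^ e = (x `^ e)^-1.
Proof. by move=> x0; rewrite -powR_inv1// -powRrM mulN1r powRN. Qed.

Lemma cvg_powRy f l (k : R) : 0 < l -> f t @[t --> +oo] --> l ->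
  f t `^ k @[t --> +oo] --> l `^ k.
Proof.
move=> l0 fl; apply: (@continuous_cvg _ _ _ _ _ _ (fun z => z `^ k)) fl.
exact: is_derive1_continuous (is_derive1_powR k l0).
Qed.

Lemma cvg0_powRy f (k : R) : 0 < k -> (\forall t \near +oo, 0 <= f t) ->
  f t @[t --> +oo] --> (0 : R) -> f t `^ k @[t --> +oo] --> (0 : R).
Proof.
move=> k0 f0 /cvgrPdist_le fl; apply/cvgrPdist_le => e e0.
near=> t.
have ft0 : 0 <= f t by near: t.
rewrite sub0r normrN ger0_norm ?powR_ge0//.
have -> : e = (e `^ k^-1) `^ k by rewrite -powRrM mulVf ?gt_eqF// powRr1// ltW.
apply: ge0_ler_powR; rewrite ?nnegrE ?powR_ge0// ?(ltW k0)//.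
have : `|0 - f t| <= e `^ k^-1 by near: t; apply: fl; rewrite powR_gt0.
by rewrite sub0r normrN ger0_norm.
Unshelve. all: by end_near. Qed.

Lemma cvgM0_bounded f g (M : R) : (\forall t \near +oo, `|g t| <= M) ->
  f t @[t --> +oo] --> (0 : R) -> f t * g t @[t --> +oo] --> (0 : R).
Proof.
move=> gM /cvgrPdist_le fl; apply/cvgrPdist_le => e e0.
have M0 : 0 < `|M| + 1 by rewrite ltr_wpDl.
near=> t.
have h1 : `|g t| <= `|M| + 1.
  have : `|g t| <= M by near: t.
  by move=> /le_trans; apply; rewrite (le_trans (ler_norm _))// lerDl.
have h2 : `|0 - f t| <= e / (`|M| + 1) by near: t; apply: fl; rewrite divr_gt0.
move: h2; rewrite !sub0r !normrN normrM ler_pdivlMr// => h2.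
by rewrite (le_trans _ h2)// ler_wpM2l.
Unshelve. all: by end_near. Qed.

(** Factors c >= 1 keep c t inside a half-line on which the hypotheses hold. A factor below 1 is
    reduced to its inverse by substituting c t for t and inverting the quotient. *)
Lemma cvg_ratio_gt0 f (th : R) : (\forall t \near +oo, f t != 0) ->
  (forall c, 1 <= c -> f (c * t) / f t @[t --> +oo] --> c `^ th) ->
  forall c, 0 < c -> f (c * t) / f t @[t --> +oo] --> c `^ th.
Proof.
move=> f0 h c c0; have [c1|c1] := leP 1 c; first exact: h.
have ci : 1 <= c^-1 by rewrite invf_ge1// ltW.
have /(cvg_comp _ _ (cvg_scaley c0)) := h _ ci.
have -> : c `^ th = (c^-1 `^ th)^-1.
  by rewrite powR_invr ?invrK// ltW.
move=> /(@cvgV R R _ _ _ _ _) H.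
have {}H := H (lt0r_neq0 (powR_gt0 _ (lt_le_trans ltr01 ci))).
apply: near_eq_cvgy H; near=> t => /=.
by rewrite mulrA mulVf ?gt_eqF// mul1r invf_div.
Unshelve. all: by end_near. Qed.

End real_lemmas.

(** * Integrals over segments *)

Section integrals.
Context {R : realType}.
Notation mu := (@lebesgue_measure R).

Lemma Rintegral01_cvg0 (H : R -> R -> R) (K : R) :
  (\forall s \near +oo, {within `[0, 1], continuous (H s)} /\
     forall x, 0 <= x <= 1 -> `|H s x| <= K) ->
  (forall x, 0 <= x <= 1 -> H s x @[s --> +oo] --> (0 : R)) ->
  \int[mu]_(x in `[0, 1]) H s x @[s --> +oo] --> (0 : R).
Proof.
move=> HK H0; apply/cvg_pinftyP => u uoo.
have [N _ NP] := uoo _ HK.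
(* Dominated convergence asks for its bounds at every index, while [HK] gives them only from some
   index N on; hence the shifted sequence. *)
rewrite -(cvg_shiftn N).
have m01 : measurable (`[0, 1] : set R) by [].
have iK : mu.-integrable `[0, 1] (EFin \o cst K).
  apply: continuous_compact_integrable; first exact: segment_compact.
  by apply: continuous_subspaceT => x; exact: cst_continuous.
have [] := @dominated_convergence _ _ _ mu `[0, 1] m01
  (fun n x => (H (u (n + N)%N) x)%:E) (cst 0%E) (EFin \o cst K).
- move=> n; apply/measurable_EFinP; apply: subspace_continuous_measurable_fun => //.
  by apply: (NP _ _).1 => /=; rewrite leq_addl.
- exact: measurable_cst.
- apply: aeW => x /= /[!in_itv]/= x01; apply: cvg_EFin; first exact: nearW.
  rewrite /comp/= (cvg_shiftn N (fun n => H (u n) x)).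
  by have /cvg_pinftyP := H0 _ x01; apply.
- exact: iK.
- apply: aeW => x n /= /[!in_itv]/= x01; rewrite lee_fin.
  by apply: (NP _ _).2 => //=; rewrite leq_addl.
- move=> _ _; rewrite integral0 => /fine_cvgP[_]; rewrite /comp/=; exact.
Qed.

Lemma within_continuous_at (a b : R) (f : R -> R) :
  (forall x, a <= x <= b -> {for x, continuous f}) ->
  {within `[a, b], continuous f}.
Proof.
by move=> fc; apply: continuous_in_subspaceT => x; rewrite inE/= in_itv/=; exact: fc.
Qed.

Lemma Rintegral_is_derive (f F : R -> R) (a b : R) : a <= b ->
  (forall x, a <= x <= b -> is_derive x 1 F (f x)) ->
  (forall x, a <= x <= b -> {for x, continuous f}) ->
  \int[mu]_(x in `[a, b]) f x = F b - F a.
Proof.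
move=> ab dF cf; move: ab dF cf; rewrite le_eqVlt => /predU1P[<- _ _|ab dF cf].
  by rewrite subrr set_itv1 Rintegral_set1.
rewrite /Rintegral (@continuous_FTC2 _ f F)//.
- exact: within_continuous_at.
- have cF x : a <= x <= b -> {for x, continuous F}.
    by move=> /dF; exact: is_derive1_continuous.
  split.
  + by move=> x /[!in_itv]/= /andP[ax xb]; have [] := dF x; rewrite // !ltW.
  + by apply: cvg_at_right_filter; apply: cF; rewrite lexx ltW.
  + by apply: cvg_at_left_filter; apply: cF; rewrite lexx ltW.
- move=> x /[!in_itv]/= /andP[ax xb]; rewrite derive1E.
  by have [|_] := dF x; rewrite // !ltW.
Qed.

End integrals.

(** * Karamata's theorem for a primitive *)

Section regularly_varying_primitive.
Context {R : realType}.
Implicit Types (a b c d e x y z l s t : R).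
Variables (v f : R -> R) (m s0 : R).
Hypotheses (m0 : 0 < m) (s00 : 0 < s0)
  (vf : forall s, s0 <= s -> is_derive s 1 v (f s))
  (fc : forall s, s0 <= s -> {for s, continuous f})
  (f0 : forall s, s0 <= s -> 0 < f s)
  (v0 : forall s, s0 <= s -> 0 < v s)
  (frv : forall c, 1 <= c -> f (c * s) / f s @[s --> +oo] --> c `^ (m - 1)).

Let is_derive_scale c s : 0 < c -> s0 <= c * s ->
  is_derive s 1 (fun x => v (c * x)) (c * f (c * s)).
Proof. by move=> c0 cs; exact: is_derive_comp_scale (vf cs). Qed.

Let v_ndecr s t : s0 <= s -> s <= t -> v s <= v t.
Proof. by apply: is_derive_ge0_le vf _ => // z /f0/ltW. Qed.

(** As 2^(m - 1) > 1/2, eventually 2 f(2 s) >= f(s), so v(2 s) - v(s) is nondecreasing. Each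
    doubling of s therefore adds at least a fixed amount d > 0 to v. *)
Lemma primitive_cvgy : v s @[s --> +oo] --> +oo.
Proof.
have s0_gt0 := s00; have h2 : (1 : R) <= 2 by lra.
have c2 : (1 : R) < 2 `^ m.
  have : (1 : R) `^ m < 2 `^ m by apply: gt0_ltr_powR; rewrite ?nnegrE//; lra.
  by rewrite powR1.
have : \forall s \near +oo, 2^-1 <= f (2 * s) / f s.
  have /cvgr_ge := frv h2; apply.
  have -> : (2 : R) `^ (m - 1) = 2 `^ m / 2 by rewrite powR_sub1.
  by rewrite ltr_pdivlMr// mulVf// pnatr_eq0.
move=> /near_pinftyP/(_ s0)[s1 s01 hs1].
have : 0 < v (2 * s1) - v s1.
  by rewrite subr_gt0; apply: (is_derive_gt0_lt vf f0) => //; lra.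
move dE : (v (2 * s1) - v s1) => d d0.
have vd s : s1 <= s -> v s + d <= v (2 * s).
  move=> s1s; rewrite -lerBrDl -dE.
  apply: (@is_derive_ge0_le R (fun s => v (2 * s) - v s)
    (fun s => 2 * f (2 * s) - f s) s1) => // z sz.
    apply: is_deriveB; [apply: is_derive_scale|apply: vf]; lra.
  have fz : 0 < f z by apply: f0; lra.
  by have := hs1 _ sz; rewrite ler_pdivlMr//; lra.
have vn n : v s1 + n%:R * d <= v (2 ^+ n * s1).
  elim: n => [|n ih]; first by rewrite mul0r addr0 expr0 mul1r.
  rewrite exprS -mulrA (le_trans _ (vd _ _)) ?ler_peMl ?exprn_ege1//; lra.
apply/cvgryPge => A.
pose n := Num.truncn `|(A - v s1) / d|.
apply: (@near_pinftyS _ (2 ^+ n.+1 * s1)) => s ns.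
have n1 : s1 <= 2 ^+ n.+1 * s1 by rewrite ler_peMl ?exprn_ege1//; lra.
have := v_ndecr (le_trans s01 n1) ns.
apply: le_trans; apply: le_trans (vn _).
rewrite -lerBlDl -ler_pdivrMr// (le_trans (ler_norm _))// ltW//.
exact: truncnS_gt.
Qed.

(** This is l'Hopital's argument in the form infinity over infinity: the derivative of c^m v(s) -
    v(c s) is at most (e/2) f(s) in absolute value, and integration bounds the difference itself by
    (e/2) v(s) plus a constant. *)
Lemma primitive_rv c : 1 <= c -> v (c * s) / v s @[s --> +oo] --> c `^ m.
Proof.
move=> c1; have s0_gt0 := s00; have c0 : 0 < c by lra.
apply/cvgrPdist_le => e e0.
have e20 : 0 < e / 2 by lra.
have /cvgrPdist_le/(_ (e / 2 / c)) := frv c1.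
move=> /(_ (divr_gt0 e20 c0)) /near_pinftyP/(_ s0)[s1 s01 hs1].
have key s : s1 <= s -> `|c `^ m * f s - c * f (c * s)| <= e / 2 * f s.
  move=> s1s; have fs : 0 < f s by apply: f0; lra.
  have := hs1 _ s1s.
  have -> : c `^ (m - 1) - f (c * s) / f s
      = (c `^ m * f s - c * f (c * s)) / (c * f s).
    by rewrite powR_sub1//; field; rewrite !gt_eqF.
  rewrite normrM normfV [X in _ / X]gtr0_norm ?mulr_gt0//.
  by rewrite ler_pdivrMr ?mulr_gt0// mulrA divfK ?gt_eqF.
(* The constant of integration at [s1]; since v tends to infinity it is eventually below (e/2) v(s),
   the other half of the tolerance. *)
pose C := `|c `^ m * v s1 - v (c * s1)| + e / 2 * v s1.
have cs z : s1 <= z -> s0 <= c * z.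
  by move=> sz; rewrite (le_trans s01)// (le_trans sz)// ler_peMl//; lra.
have bnd s : s1 <= s -> `|c `^ m * v s - v (c * s)| <= C + e / 2 * v s.
  have dD z : s1 <= z -> is_derive z 1 (fun s => c `^ m * v s - v (c * s))
      (c `^ m * f z - c * f (c * z)).
    move=> s1z; apply: is_deriveB.
      by apply: is_deriveZ; apply: vf; lra.
    by apply: is_derive_scale => //; exact: cs.
  have dE z : s1 <= z -> is_derive z 1 (fun s => e / 2 * v s) (e / 2 * f z).
    by move=> s1z; apply: is_deriveZ; apply: vf; lra.
  move=> s1s; rewrite ler_norml; apply/andP; split.
  - have : c `^ m * v s1 - v (c * s1) + e / 2 * v s1
        <= c `^ m * v s - v (c * s) + e / 2 * v s.
      apply: (is_derive_ge0_le (fun z h => is_deriveD (dD z h) (dE z h)) _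
        (lexx s1) s1s) => z sz.
      by have := key _ sz; rewrite ler_norml => /andP[]; lra.
    have := ler_norm (- (c `^ m * v s1 - v (c * s1))); rewrite normrN /C.
    have : 0 < e / 2 * v s1 by rewrite mulr_gt0// v0//.
    lra.
  - have : - (c `^ m * v s1 - v (c * s1)) + e / 2 * v s1
        <= - (c `^ m * v s - v (c * s)) + e / 2 * v s.
      apply: (is_derive_ge0_le
        (fun z h => is_deriveD (is_deriveN (dD z h)) (dE z h)) _
        (lexx s1) s1s) => z sz.
      by have := key _ sz; rewrite ler_norml => /andP[]; lra.
    have := ler_norm (c `^ m * v s1 - v (c * s1)); rewrite /C.
    have : 0 < e / 2 * v s1 by rewrite mulr_gt0// v0//.
    lra.
near=> s.
have s1s : s1 <= s by near: s; apply: nbhs_pinfty_ge; rewrite num_real.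
have vs : 0 < v s by apply: v0; lra.
have -> : c `^ m - v (c * s) / v s = (c `^ m * v s - v (c * s)) / v s.
  by field; rewrite gt_eqF.
rewrite normrM normfV (gtr0_norm vs) ler_pdivrMr// (le_trans (bnd _ s1s))//.
have : C / (e / 2) <= v s by near: s; move/cvgryPge: primitive_cvgy; apply.
by rewrite ler_pdivrMr//; lra.
Unshelve. all: by end_near. Qed.

(** The logarithmic derivative of v with respect to ln s. Its index of variation is 1 + (m - 1) - m
    = 0, and Karamata's theorem says that it tends to m. *)
Let b (s : R) := s * f s / v s.

Let b_cont s : s0 <= s -> {for s, continuous b}.
Proof.
move=> s0s; apply: cvgM; [apply: cvgM; [exact: cvg_id|exact: fc]|].
by apply: cvgV; [rewrite gt_eqF ?v0|exact: is_derive1_continuous (vf s0s)].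
Qed.

Let b_gt0 s : s0 <= s -> 0 < b s.
Proof.
by move=> s0s; rewrite divr_gt0 ?v0// mulr_gt0 ?f0// (lt_le_trans s00).
Qed.

Let b_rv c : 1 <= c -> b (c * s) / b s @[s --> +oo] --> (1 : R).
Proof.
move=> c1; have c0 : 0 < c by lra.
have H : c * (f (c * s) / f s) / (v (c * s) / v s) @[s --> +oo]
    --> c * c `^ (m - 1) / c `^ m.
  apply: cvgM; first by apply: cvgM; [exact: cvg_cst|exact: frv].
  by apply: cvgV; [rewrite gt_eqF ?powR_gt0|exact: primitive_rv].
have -> : (1 : R) = c * c `^ (m - 1) / c `^ m.
  by rewrite mulr_powRB1 ?ltW// divff// gt_eqF ?powR_gt0.
apply: near_eq_cvgy H; apply: (@near_pinftyS _ s0) => s s0s.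
have s0cs : s0 <= c * s.
  by rewrite (le_trans s0s)// ler_peMl// ltW// (lt_le_trans s00).
have ? := f0 s0s; have ? := f0 s0cs; have ? := v0 s0s; have ? := v0 s0cs.
have ? := lt_le_trans s00 s0s.
by rewrite /b; field; rewrite !gt_eqF.
Qed.

Let s_exp s x : s0 <= s -> 0 <= x -> s0 <= s * expR x.
Proof.
move=> s0s x0; rewrite (le_trans s0s)// ler_peMr//.
  by rewrite ltW// (lt_le_trans s00).
by rewrite -(expR0 R) ler_expR.
Qed.

Let comp_exp_cont (g : R -> R) s : s0 <= s ->
  (forall s, s0 <= s -> {for s, continuous g}) ->
  forall x, 0 <= x <= 1 -> {for x, continuous (fun x => g (s * expR x))}.
Proof.
move=> s0s gc x /andP[x0 _].
apply: (@continuous_comp _ _ _ (fun x => s * expR x) g).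
  by apply: cvgM; [exact: cvg_cst|exact: continuous_expR].
exact/gc/s_exp.
Qed.

(** On the logarithmic scale x, the function b(s e^x) is the derivative of ln v(s e^x), so the mean
    of b is known exactly. *)
Let int_b s : s0 <= s ->
  \int[lebesgue_measure]_(x in `[0, 1]) b (s * expR x) = ln (v (expR 1 * s) / v s).
Proof.
move=> s0s.
transitivity (ln (v (s * expR 1)) - ln (v (s * expR 0))); last first.
  by rewrite expR0 mulr1 [expR 1 * s]mulrC ln_div// posrE v0// s_exp.
apply: (@Rintegral_is_derive R (fun x => b (s * expR x))
  (fun x => ln (v (s * expR x)))) => //.
- move=> x /andP[x0 x1]; have sx := s_exp s0s x0.
  have h1 : is_derive x 1 (fun x => s * expR x) (s * expR x).
    exact: (is_deriveZ s (is_derive_expR x)).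
  have h2 := @is_derive1_comp _ v _ x _ _ (vf sx) h1.
  have := is_derive1_comp (is_derive1_ln (v0 sx)) h2.
  by rewrite /b mulrC [f _ * _]mulrC.
- exact: comp_exp_cont.
Qed.

Let int_b_cvg :
  \int[lebesgue_measure]_(x in `[0, 1]) b (s * expR x) @[s --> +oo] --> m.
Proof.
have h : ln (v (expR 1 * s) / v s) @[s --> +oo] --> m.
  rewrite -[m in X in _ --> X]expRK -[m in X in _ --> X]mul1r expRM.
  apply: (@continuous_cvg _ _ _ _ _ _ (@ln R)).
    by apply: continuous_ln; rewrite powR_gt0// expR_gt0.
  by apply: primitive_rv; rewrite -(expR0 R) ler_expR.
apply: near_eq_cvgy h; apply: (@near_pinftyS _ s0) => s; exact: int_b.
Qed.

Let int01_cst (c : R) : \int[lebesgue_measure]_(x in `[0, 1]) (cst c x) = c.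
Proof.
transitivity (c * 1 - c * 0); last by rewrite mulr0 mulr1 subr0.
apply: (@Rintegral_is_derive R (cst c) (fun x => c * x)) => // x _.
  exact: is_derive_mull.
exact: cst_continuous.
Qed.

Let int01_continuous (g : R -> R) :
  (forall x, 0 <= x <= 1 -> {for x, continuous g}) ->
  lebesgue_measure.-integrable `[0, 1] (EFin \o g).
Proof.
move=> gc; apply: continuous_compact_integrable; first exact: segment_compact.
exact: within_continuous_at.
Qed.

(* [b] is only known to vary slowly pointwise; capping the ratio at 1 makes
   dominated convergence applicable and bounds [b] from its mean. *)
Let b_bounded : \forall s \near +oo, b s <= 2 * m + 2.
Proof.
pose g (s x : R) := Num.min (b (s * expR x) / b s) 1.
have gc s : s0 <= s -> forall x, 0 <= x <= 1 -> {for x, continuous (g s)}.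
  move=> s0s x x01; apply: continuous_min; last exact: cst_continuous.
  apply: cvgM; last exact: cvg_cst.
  exact: comp_exp_cont b_cont _ x01.
have g01 s : s0 <= s -> forall x, 0 <= x <= 1 -> 0 <= g s x <= 1.
  move=> s0s x /andP[x0 x1]; rewrite ge_min lexx orbT andbT le_min ler01 andbT.
  by rewrite divr_ge0// ltW// b_gt0// s_exp.
have : \int[lebesgue_measure]_(x in `[0, 1]) (1 - g s x) @[s --> +oo] --> (0 : R).
  apply: (@Rintegral01_cvg0 _ _ 1).
    apply: (@near_pinftyS _ s0) => s s0s; split.
      apply: within_continuous_at => x x01.
      by apply: cvgB; [exact: cvg_cst|exact: gc].
    by move=> x /(g01 _ s0s)/andP[? ?]; rewrite ger0_norm; lra.
  move=> x /andP[x0 x1].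
  have ex1 : 1 <= expR x by rewrite -(expR0 R) ler_expR.
  have /cvgrPdist_le H := b_rv ex1; apply/cvgrPdist_le => e e0.
  apply: filterS (H _ e0) => s; rewrite sub0r normrN [expR x * s]mulrC /g.
  by rewrite minEle; case: ifP => // _ _; rewrite subrr normr0 ltW.
move=> /cvgr_le/(_ 2^-1) H; have {}H := H ltac:(lra).
have /cvgr_le/(_ (m + 1)) H' := int_b_cvg; have {}H' := H' ltac:(lra).
near=> s.
have s0s : s0 <= s by near: s; apply: nbhs_pinfty_ge; rewrite num_real.
have h1 : \int[lebesgue_measure]_(x in `[0, 1]) (1 - g s x) <= 2^-1 by near: s.
have h2 : \int[lebesgue_measure]_(x in `[0, 1]) b (s * expR x) <= m + 1 by near: s.
have bs := b_gt0 s0s.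
have iB := int01_continuous (comp_exp_cont s0s b_cont).
have i1 := int01_continuous (fun x _ => @cst_continuous R R 1 x).
have iB' : lebesgue_measure.-integrable `[0, 1]
    (EFin \o (fun x => b (s * expR x) / b s)).
  apply: int01_continuous => x x01; apply: cvgM; last exact: cvg_cst.
  exact: comp_exp_cont b_cont _ x01.
(* Writing I1 and I2 for the integrals in [h1] and [h2], the cap gives 1 - I2 / b(s) <= I1 <= 1/2,
   hence b(s) <= 2 I2 <= 2 (m + 1). *)
have : \int[lebesgue_measure]_(x in `[0, 1]) (1 - b (s * expR x) / b s)
   <= \int[lebesgue_measure]_(x in `[0, 1]) (1 - g s x).
  apply: le_Rintegral => //.
  - apply: int01_continuous => x x01; apply: cvgB; first exact: cvg_cst.
    by apply: cvgM; [exact: comp_exp_cont b_cont _ x01|exact: cvg_cst].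
  - apply: int01_continuous => x x01; apply: cvgB; first exact: cvg_cst.
    exact: gc.
  - by move=> x _; rewrite lerD2l lerN2 /g ge_min lexx.
rewrite RintegralB// RintegralZr// (int01_cst 1).
move: h1 h2; set I1 := Rintegral _ _ _; set I2 := Rintegral _ _ _.
move=> h1 h2 h3.
have : 2^-1 <= I2 / b s by lra.
by rewrite ler_pdivlMr//; lra.
Unshelve. all: by end_near. Qed.

Lemma primitive_Karamata : s * f s / v s @[s --> +oo] --> m.
Proof.
have H : \int[lebesgue_measure]_(x in `[0, 1]) (b (s * expR x) - b s)
    @[s --> +oo] --> (0 : R).
  apply: (@Rintegral01_cvg0 _ _ (2 * m + 2)).
    have /near_pinftyP/(_ s0)[s1 s01 hb] := b_bounded.
    apply: (@near_pinftyS _ s1) => s s1s; have s0s := le_trans s01 s1s; split.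
      apply: within_continuous_at => x x01.
      by apply: cvgB; [exact: comp_exp_cont b_cont _ x01|exact: cvg_cst].
    move=> x /andP[x0 x1].
    have h1 := b_gt0 s0s; have h2 := b_gt0 (s_exp s0s x0).
    have h3 := hb _ s1s; have h4 : b (s * expR x) <= 2 * m + 2.
      apply: hb; rewrite (le_trans s1s)// ler_peMr//.
        by rewrite ltW// (lt_le_trans s00).
      by rewrite -(expR0 R) ler_expR.
    by rewrite ler_norml; apply/andP; split; lra.
  move=> x /andP[x0 x1].
  have ex1 : 1 <= expR x by rewrite -(expR0 R) ler_expR.
  (* Slow variation controls only quotients of values of b; its boundedness turns this into a
     vanishing difference. *)
  have : (b (expR x * s) / b s - 1) * b s @[s --> +oo] --> (0 : R).
    apply: (@cvgM0_bounded _ _ _ (2 * m + 2)).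
      have h := b_bounded; near=> s.
      rewrite gtr0_norm; first by near: s.
      by apply: b_gt0; near: s; apply: nbhs_pinfty_ge; rewrite num_real.
    by rewrite -(subrr 1); apply: cvgB; [exact: b_rv|exact: cvg_cst].
  apply: near_eq_cvgy; apply: (@near_pinftyS _ s0) => s s0s.
  by rewrite mulrBl divfK ?gt_eqF ?b_gt0// mul1r [expR x * s]mulrC.
have := cvgB int_b_cvg H; rewrite subr0 => /(_ _).
apply: near_eq_cvgy; apply: (@near_pinftyS _ s0) => s s0s.
rewrite opprfctE RintegralB//; last 2 first.
- exact/int01_continuous/comp_exp_cont.
- by apply: int01_continuous => x _; exact: cst_continuous.
by rewrite (int01_cst (b s)) subKr.
Unshelve. all: by end_near. Qed.

End regularly_varying_primitive.

(** * The equation in the variable s = Q(t) *)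

Section transformed_equation.
Context {R : realType}.
Implicit Types (a b d e x y z l s t : R).
Variables (alpha k c s0 : R) (w v dv P T : R -> R).
Hypotheses (alpha_gt1 : 1 < alpha) (k_conj : k * (alpha - 1) = 1)
  (c_gt0 : 0 < c) (s0_gt0 : 0 < s0)
  (w_derive : forall s, s0 <= s -> is_derive s 1 w (v s `^ k / s ^+ 2))
  (v_derive : forall s, s0 <= s -> is_derive s 1 v (dv s))
  (dv_cont : forall s, s0 <= s -> {for s, continuous dv})
  (w_gt0 : forall s, s0 <= s -> 0 < w s)
  (v_gt0 : forall s, s0 <= s -> 0 < v s)
  (dv_gt0 : forall s, s0 <= s -> 0 < dv s)
  (dvE : forall s, s0 <= s -> dv s = P s * w (T s) `^ (alpha - 1))
  (P_gt0 : forall s, s0 <= s -> 0 < P s)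
  (T_bounds : \forall s \near +oo, [/\ s0 <= T s, T s <= s & c * s <= T s])
  (P_rv : forall l, 0 < l -> P (l * s) / P s @[s --> +oo] --> l `^ (alpha - 2))
  (P_o : P s / s `^ (alpha - 2) @[s --> +oo] --> (0 : R)).

Let k_gt0 : 0 < k.
Proof.
have h := alpha_gt1; have : 0 < k * (alpha - 1) by rewrite k_conj.
by rewrite pmulr_lgt0//; lra.
Qed.

Let alpha1_gt0 : 0 < alpha - 1. Proof. by rewrite subr_gt0. Qed.

Let s_gt0 s : s0 <= s -> 0 < s. Proof. exact: lt_le_trans. Qed.

Let dw_gt0 s : s0 <= s -> 0 < v s `^ k / s ^+ 2.
Proof. by move=> h; rewrite divr_gt0 ?exprn_gt0 ?powR_gt0 ?v_gt0 ?s_gt0. Qed.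

Let w_ndecr s t : s0 <= s -> s <= t -> w s <= w t.
Proof. by apply: (is_derive_ge0_le w_derive) => z /dw_gt0/ltW. Qed.

Let v_ndecr s t : s0 <= s -> s <= t -> v s <= v t.
Proof. by apply: (is_derive_ge0_le v_derive) => z /dv_gt0/ltW. Qed.

Let powRK x : 0 <= x -> (x `^ (alpha - 1)) `^ k = x.
Proof. by move=> x0; rewrite -powRrM mulrC k_conj powRr1. Qed.

Let powRKV x : 0 <= x -> (x `^ k) `^ (alpha - 1) = x.
Proof. by move=> x0; rewrite -powRrM k_conj powRr1. Qed.

Let powR_div x y e : 0 <= x -> 0 <= y -> (x / y) `^ e = x `^ e / y `^ e.
Proof.
by move=> x0 y0; rewrite powRM ?invr_ge0// powR_invr.
Qed.

Let le_powR x y : 0 <= x -> x <= y -> x `^ (alpha - 1) <= y `^ (alpha - 1).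
Proof.
move=> x0 xy; apply: (ge0_ler_powR (ltW alpha1_gt0)) => //.
by rewrite nnegrE (le_trans x0).
Qed.

(** Eventually P(s) <= e (alpha - 1) s^(alpha - 2) and w(T s) <= w(s), so v' <= e (alpha - 1)
    s^(alpha - 2) w^(alpha - 1). The right-hand side is the derivative of e (s w)^(alpha - 1)
    without its nonnegative term in w'. *)
Lemma le_pow_sw e : 0 < e -> exists2 s1, s0 <= s1 & forall s, s1 <= s ->
  v s <= v s1 + e * (s * w s) `^ (alpha - 1).
Proof.
move=> e0; have e1 : 0 < e * (alpha - 1) by rewrite mulr_gt0.
have /cvgr_le/(_ _ e1) HP := P_o.
have [s1 s01 Hs1] := near_pinftyP (filterI T_bounds HP) s0.
exists s1 => // s s1s.
pose dsw s := (alpha - 1) * (s * w s) `^ (alpha - 1 - 1) *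
  (s * (v s `^ k / s ^+ 2) + w s).
suff : e * (s1 * w s1) `^ (alpha - 1) - v s1 <= e * (s * w s) `^ (alpha - 1) - v s.
  have : 0 <= e * (s1 * w s1) `^ (alpha - 1) by rewrite mulr_ge0 ?powR_ge0 ?ltW.
  lra.
have dG z : s1 <= z ->
    is_derive z 1 (fun s => e * (s * w s) `^ (alpha - 1) - v s) (e * dsw z - dv z).
  move=> s1z; have s0z := le_trans s01 s1z.
  apply: is_deriveB; last exact: v_derive.
  apply: is_deriveZ.
  have sw0 : 0 < z * w z by rewrite mulr_gt0 ?w_gt0 ?s_gt0.
  have h2 : is_derive z 1 (fun x => x * w x) (z * (v z `^ k / z ^+ 2) + w z).
    have := is_deriveM (is_derive_id z 1) (w_derive s0z).
    by rewrite /GRing.scale/= mulr1.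
  exact: (@is_derive1_comp R (fun u => u `^ (alpha - 1)) (fun x => x * w x)
    z _ _ (is_derive1_powR (alpha - 1) sw0) h2).
apply: (is_derive_ge0_le dG _ (lexx s1) s1s) => z s1z.
have s0z := le_trans s01 s1z.
have [[s0T Tz _] PL] := Hs1 _ s1z.
have z0 := s_gt0 s0z; have w0 := w_gt0 s0z.
rewrite subr_ge0 dvE//.
move: PL; rewrite ler_pdivrMr ?powR_gt0// => PL.
have h1 : w (T z) `^ (alpha - 1) <= w z `^ (alpha - 1).
  by apply: le_powR; [exact/ltW/w_gt0|exact: w_ndecr].
apply: (le_trans (ler_pM (ltW (P_gt0 s0z)) (powR_ge0 _ _) PL h1)).
rewrite /dsw -!mulrA ler_pM2l// ler_pM2l// powRM ?(ltW z0) ?(ltW w0)//.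
have -> : alpha - 1 - 1 = alpha - 2 by lra.
rewrite -mulrA ler_pM2l ?powR_gt0//.
have -> : w z `^ (alpha - 1) = w z `^ (alpha - 2) * w z.
  have -> : alpha - 2 = alpha - 1 - 1 by lra.
  by rewrite [RHS]mulrC mulr_powRB1// ltW.
rewrite ler_pM2l ?powR_gt0// lerDr mulr_ge0 ?(ltW z0)// ltW//.
exact: dw_gt0.
Qed.

Lemma v_div_sw : v s `^ k / (s * w s) @[s --> +oo] --> (0 : R).
Proof.
have H : v s / (s * w s) `^ (alpha - 1) @[s --> +oo] --> (0 : R).
  apply/cvgrPdist_le => e e0.
  have e20 : 0 < e / 2 by rewrite divr_gt0.
  have [s1 s01 Hs1] := le_pow_sw e20.
  near=> s.
  have s1s : s1 <= s by near: s; apply: nbhs_pinfty_ge; rewrite num_real.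
  have s0s := le_trans s01 s1s.
  have sw0 : 0 < (s * w s) `^ (alpha - 1).
    by rewrite powR_gt0// mulr_gt0 ?w_gt0 ?s_gt0.
  rewrite sub0r normrN gtr0_norm; last by rewrite divr_gt0// v_gt0.
  rewrite ler_pdivrMr// (le_trans (Hs1 _ s1s))//.
  suff : v s1 <= e / 2 * (s * w s) `^ (alpha - 1) by lra.
  rewrite mulrC -ler_pdivrMr// -[v s1 / _]powRKV; last first.
    by rewrite divr_ge0// ltW// v_gt0.
  apply: le_powR; first exact: powR_ge0.
  (* As w increases, s w(s) >= s w(s0) outgrows any constant, in particular the one that absorbs
     [v s1], whether w is bounded or not. *)
  apply: (@le_trans _ _ (s * w s0)); last first.
    by rewrite ler_pM2l ?s_gt0// w_ndecr.
  rewrite -ler_pdivrMr ?w_gt0//.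
have : (v s / (s * w s) `^ (alpha - 1)) `^ k @[s --> +oo] --> (0 : R).
  apply: cvg0_powRy => //; apply: (@near_pinftyS _ s0) => s s0s.
  by rewrite divr_ge0 ?powR_ge0// ltW// v_gt0.
apply: near_eq_cvgy; apply: (@near_pinftyS _ s0) => s s0s.
by rewrite powR_div ?powR_ge0 ?powRK//?mulr_ge0// ltW// ?v_gt0 ?w_gt0 ?s_gt0.
Unshelve. all: by end_near. Qed.

(** By the mean value theorem, ln w(l s) - ln w(s) = (l - 1) s w'(z)/w(z) with s <= z, which is at
    most l times z w'(z)/w(z) = v(z)^k / (z w(z)). *)
Lemma w_sv1 l : 1 <= l -> w (l * s) / w s @[s --> +oo] --> (1 : R).
Proof.
move=> l1.
have ls s : s0 <= s -> s <= l * s by move=> h; rewrite ler_peMl// ltW// s_gt0.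
have dln s : s0 <= s ->
    is_derive s 1 (fun x => ln (w x)) ((w s)^-1 * (v s `^ k / s ^+ 2)).
  by move=> h; exact: is_derive1_comp (is_derive1_ln (w_gt0 h)) (w_derive h).
have H : ln (w (l * s)) - ln (w s) @[s --> +oo] --> (0 : R).
  apply/cvgrPdist_le => e e0.
  have el : 0 < e / l by rewrite divr_gt0//; lra.
  have /cvgr_le/(_ _ el)/near_pinftyP/(_ s0)[s1 s01 Hs1] := v_div_sw.
  apply: (@near_pinftyS _ s1) => s s1s; have s0s := le_trans s01 s1s.
  have [z /andP[sz _]|z /andP[sz zls] ->] :=
    MVT_is_derive (ls _ s0s) (fun z h => dln z (_ h)).
    exact: le_trans sz.
  have s0z := le_trans s0s sz.
  have z0 := s_gt0 s0z; have s'0 := s_gt0 s0s.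
  have lss := ls _ s0s.
  rewrite sub0r normrN ger0_norm; last first.
    rewrite mulr_ge0 ?subr_ge0// mulr_ge0 ?invr_ge0 ?(ltW (w_gt0 s0z))//.
    exact/ltW/dw_gt0.
  have -> : (w z)^-1 * (v z `^ k / z ^+ 2) * (l * s - s) =
      v z `^ k / (z * w z) * ((l * s - s) / z).
    by have := w_gt0 s0z; move=> ?; field; rewrite !gt_eqF.
  have -> : e = e / l * l by rewrite divfK// gt_eqF//; lra.
  apply: ler_pM.
  - by rewrite divr_ge0 ?powR_ge0// mulr_ge0// ltW// w_gt0.
  - by rewrite divr_ge0 ?subr_ge0// ltW.
  - by apply: Hs1; rewrite (le_trans s1s).
  - rewrite ler_pdivrMr//.
    have : l * s <= l * z by rewrite ler_pM2l//; lra.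
    lra.
have : expR (ln (w (l * s)) - ln (w s)) @[s --> +oo] --> (1 : R).
  rewrite -[X in _ --> X]expR0.
  by apply: (@continuous_cvg _ _ _ _ _ _ (@expR R)) H; exact: continuous_expR.
apply: near_eq_cvgy; apply: (@near_pinftyS _ s0) => s s0s.
rewrite expRB !lnK// posrE w_gt0// (le_trans s0s)// ls//.
Qed.

Lemma w_sv l : 0 < l -> w (l * s) / w s @[s --> +oo] --> (1 : R).
Proof.
rewrite -(powRr0 l); move: l; apply: cvg_ratio_gt0.
  by apply: (@near_pinftyS _ s0) => s s0s; rewrite gt_eqF ?w_gt0.
by move=> l l1; rewrite powRr0; exact: w_sv1.
Qed.

(** Monotonicity squeezes the quotient between w(c s)/w(s) and 1, so slow variation at the single
    factor c removes the delay. *)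
Lemma w_delay : w (T s) / w s @[s --> +oo] --> (1 : R).
Proof.
have H := w_sv c_gt0.
apply: (@squeeze_cvgr _ _ _ _ (fun s => w (c * s) / w s) (cst 1) _ _ _ H);
  last exact: cvg_cst.
near=> s.
have [s0T Ts cT] : [/\ s0 <= T s, T s <= s & c * s <= T s] by near: s.
have s0s := le_trans s0T Ts; have w0 := w_gt0 s0s.
rewrite ler_pdivrMr// divfK ?gt_eqF// ler_pdivrMr// mul1r.
rewrite (w_ndecr s0T Ts) andbT w_ndecr//.
by rewrite mulrC -ler_pdivrMr.
Unshelve. all: by end_near. Qed.

(** The index comes from P alone: w(T(l s))/w(T s) tends to 1, as it telescopes through w(l s) and
    w(s). The exponent has the form m - 1 with m = alpha - 1, to match Karamata's theorem above. *)
Lemma dv_rv l : 1 <= l -> dv (l * s) / dv s @[s --> +oo] --> l `^ (alpha - 1 - 1).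
Proof.
move=> l1; have l0 : 0 < l by lra.
have HT : (w (T (l * s)) / w (l * s)) * (w (l * s) / w s) / (w (T s) / w s)
    @[s --> +oo] --> (1 * 1 / 1 : R).
  apply: cvgM; last by apply: cvgV; [exact: oner_neq0|exact: w_delay].
  apply: cvgM; last exact: w_sv.
  exact: (cvg_comp _ _ (cvg_scaley l0) w_delay).
rewrite divr1 mulr1 in HT.
have {}HT := cvg_powRy (k := alpha - 1) ltr01 HT; rewrite powR1 in HT.
have := cvgM (P_rv l0) HT => /(_ _); rewrite mulr1.
have -> : alpha - 1 - 1 = alpha - 2 by lra.
have Tl : \forall s \near +oo,
    [/\ s0 <= T (l * s), T (l * s) <= l * s & c * (l * s) <= T (l * s)].
  exact: (cvg_scaley l0) T_bounds.
apply: near_eq_cvgy; near=> s.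
have [t1 t2 t3] :
    [/\ s0 <= T (l * s), T (l * s) <= l * s & c * (l * s) <= T (l * s)].
  by near: s.
have [t4 t5 t6] : [/\ s0 <= T s, T s <= s & c * s <= T s] by near: s.
have ? := w_gt0 t1; have ? := w_gt0 (le_trans t1 t2).
have ? := w_gt0 t4; have ? := w_gt0 (le_trans t4 t5).
have ? := P_gt0 (le_trans t4 t5).
have -> : w (T (l * s)) / w (l * s) * (w (l * s) / w s) / (w (T s) / w s)
   = w (T (l * s)) / w (T s) by field; rewrite !gt_eqF.
rewrite powR_div ?ltW// !dvE ?(le_trans t4 t5)// ?(le_trans t1 t2)//.
have ? : 0 < w (T s) `^ (alpha - 1) by rewrite powR_gt0.
by field; rewrite !gt_eqF.
Unshelve. all: by end_near. Qed.

Lemma v_cvgy : v s @[s --> +oo] --> +oo.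
Proof. exact: primitive_cvgy s0_gt0 v_derive dv_gt0 dv_rv. Qed.

Lemma v_rv l : 1 <= l -> v (l * s) / v s @[s --> +oo] --> l `^ (alpha - 1).
Proof. exact: (primitive_rv alpha1_gt0 s0_gt0 v_derive dv_gt0 v_gt0 dv_rv). Qed.

(** The limit alpha - 1 of s v'/v is inverted to k, and w(T s) in v' is replaced by w(s). The k-th
    power of this limit is the origin of the factor (beta - 1)^(beta - 1) in front of q_C. *)
Lemma v_asymptotics :
  v s / ((s * w s) `^ (alpha - 1) * (P s / s `^ (alpha - 2))) @[s --> +oo] --> k.
Proof.
have H := primitive_Karamata alpha1_gt0 s0_gt0 v_derive dv_cont dv_gt0 v_gt0 dv_rv.
have Hw := cvg_powRy (k := alpha - 1) ltr01 w_delay; rewrite powR1 in Hw.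
have a0 : alpha - 1 != 0 by rewrite gt_eqF.
have := cvgM Hw (cvgV a0 H) => /(_ _ _); rewrite mul1r.
have -> : (alpha - 1)^-1 = k.
  by apply: (mulIf a0); rewrite k_conj mulVf.
apply: near_eq_cvgy; near=> s.
have [t4 t5 t6] : [/\ s0 <= T s, T s <= s & c * s <= T s] by near: s.
have s0s := le_trans t4 t5.
have ? := w_gt0 t4; have ? := w_gt0 s0s; have ? := s_gt0 s0s.
rewrite /= powR_div ?ltW// dvE// powRM ?ltW//.
have -> : alpha - 2 = alpha - 1 - 1 by lra.
rewrite (@powR_sub1 _ s (alpha - 1))//.
have ? : 0 < w (T s) `^ (alpha - 1) by rewrite powR_gt0.
have ? : 0 < w s `^ (alpha - 1) by rewrite powR_gt0.
have ? : 0 < s `^ (alpha - 1) by rewrite powR_gt0.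
have ? := v_gt0 s0s; have ? := P_gt0 s0s.
by field; rewrite !gt_eqF.
Unshelve. all: by end_near. Qed.

(** * Slow variation of N - w when w tends to N *)

Section finite_limit.
Variable N : R.
Hypothesis w_cvg : w s @[s --> +oo] --> N.

Lemma w_lt_lim s : s0 <= s -> w s < N.
Proof.
move=> s0s; have h : w s < w (s + 1).
  by apply: (is_derive_gt0_lt w_derive dw_gt0 s0s); rewrite ltrDl.
apply: (lt_le_trans h); apply: (cvgr_to_ge w_cvg).
apply: (@near_pinftyS _ (s + 1)) => t st; apply: w_ndecr => //.
by rewrite (le_trans s0s)// lerDl.
Qed.

(** The quotient is at most 1 by monotonicity, so only a lower bound is at stake. It is l'Hopital's
    argument in the form zero over zero: v^k has index 1, hence l w'(l s)/w'(s) tends to 1. *)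
Let tail_sv1 l : 1 <= l -> (N - w (l * s)) / (N - w s) @[s --> +oo] --> (1 : R).
Proof.
move=> l1; have l0 : 0 < l by lra.
have ls s : s0 <= s -> s <= l * s by move=> h; rewrite ler_peMl// ltW// s_gt0.
pose dw s := v s `^ k / s ^+ 2.
have dwrv : l * (dw (l * s) / dw s) @[s --> +oo] --> (1 : R).
  have H := cvg_powRy (k := k) (powR_gt0 (alpha - 1) l0) (v_rv l1).
  rewrite powRK ?(ltW l0)// in H.
  have {}H : (v (l * s) / v s) `^ k / l @[s --> +oo] --> (1 : R).
    by rewrite -(divff (lt0r_neq0 l0)); apply: cvgM => //; exact: cvg_cst.
  apply: near_eq_cvgy H; apply: (@near_pinftyS _ s0) => s s0s.
  have s0ls := le_trans s0s (ls _ s0s).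
  have ? := s_gt0 s0s.
  rewrite powR_div ?(ltW (v_gt0 _))// /dw.
  have ? : 0 < v s `^ k by rewrite powR_gt0// v_gt0.
  by field; rewrite !gt_eqF.
have dwl s : s0 <= s -> is_derive s 1 (fun s => w (l * s)) (l * dw (l * s)).
  move=> s0s; have s0ls := le_trans s0s (ls _ s0s).
  by have := is_derive_comp_scale (w_derive s0ls).
apply/cvgrPdist_le => e e0.
have h1e : 1 - e < 1 by lra.
have /cvgr_ge/(_ _ h1e)/near_pinftyP/(_ s0)[s1 s01 Hs1] := dwrv.
apply: (@near_pinftyS _ s1) => s s1s; have s0s := le_trans s01 s1s.
have Nw := w_lt_lim s0s.
have h2 : w s <= w (l * s) by rewrite w_ndecr// ls.
have : 0 <= (N - w (l * s)) - (1 - e) * (N - w s).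
  have HG : (N - w (l * t)) - (1 - e) * (N - w t) @[t --> +oo]
      --> (N - N) - (1 - e) * (N - N).
    apply: cvgB.
      apply: cvgB; first exact: cvg_cst.
      exact: cvg_comp _ _ (cvg_scaley l0) w_cvg.
    by apply: cvgM; [exact: cvg_cst|apply: cvgB; [exact: cvg_cst|exact: w_cvg]].
  rewrite !subrr mulr0 subr0 in HG.
  apply: (cvgr_to_le HG).
  apply: (@near_pinftyS _ s) => t st.
  suff : - ((N - w (l * s)) - (1 - e) * (N - w s)) <=
         - ((N - w (l * t)) - (1 - e) * (N - w t)) by rewrite lerN2.
  (* G is nondecreasing, because its derivative is l w'(l t) - (1 - e) w'(t), and it tends to 0;
     hence G <= 0. *)
  pose G t := - ((N - w (l * t)) - (1 - e) * (N - w t)).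
  have dG z : s1 <= z ->
      is_derive z 1 G (- ((0 - l * dw (l * z)) - (1 - e) * (0 - dw z))).
    move=> s1z; have s0z := le_trans s01 s1z.
    apply: is_deriveN; apply: is_deriveB.
      by apply: is_deriveB; exact: dwl.
    by apply: is_deriveZ; apply: is_deriveB; exact: w_derive.
  apply: (is_derive_ge0_le dG _ s1s st) => z s1z.
  have := Hs1 _ s1z; rewrite mulrA ler_pdivlMr; first by lra.
  by apply: dw_gt0; rewrite (le_trans s01).
move=> h3; rewrite ger0_norm.
  by rewrite lerBlDl -lerBlDr ler_pdivlMr ?subr_gt0; lra.
by rewrite subr_ge0 ler_pdivrMr ?subr_gt0; lra.
Qed.

Lemma tail_sv l : 0 < l -> (N - w (l * s)) / (N - w s) @[s --> +oo] --> (1 : R).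
Proof.
rewrite -(powRr0 l); move: l; apply: (@cvg_ratio_gt0 _ (fun s => N - w s)).
  by apply: (@near_pinftyS _ s0) => s s0s; rewrite subr_eq0 gt_eqF// w_lt_lim.
by move=> l l1; rewrite powRr0; exact: tail_sv1.
Qed.

(* Since [v] increases, w(2s) - w(s) is at least a quarter of s w'(s). *)
Let dw_tail : v s `^ k / (s * (N - w s)) @[s --> +oo] --> (0 : R).
Proof.
have H : 4 * (1 - (N - w (2 * s)) / (N - w s)) @[s --> +oo] --> 4 * (1 - 1 : R).
  apply: cvgM; first exact: cvg_cst.
  by apply: cvgB; [exact: cvg_cst|apply: tail_sv].
rewrite subrr mulr0 in H.
apply: (@squeeze_cvgr _ _ _ _ (cst 0) _ _ _ _ _ H); last exact: cvg_cst.
apply: (@near_pinftyS _ s0) => s s0s.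
have s'0 := s_gt0 s0s; have Nw := w_lt_lim s0s.
have Nw0 : 0 < N - w s by rewrite subr_gt0.
rewrite divr_ge0 ?powR_ge0//; last by rewrite mulr_ge0// ltW.
have -> : 4 * (1 - (N - w (2 * s)) / (N - w s)) = 4 * (w (2 * s) - w s) / (N - w s).
  by field; rewrite gt_eqF.
rewrite invfM mulrA ler_pM2r ?invr_gt0// /cst/=.
have s2 : s <= 2 * s by lra.
have [z /andP[sz _]|z /andP[sz zls] ->] :=
  MVT_is_derive s2 (fun z h => w_derive (_ h)).
  exact: le_trans sz.
have s0z := le_trans s0s sz; have z0 := s_gt0 s0z.
have h1 : v s `^ k <= v z `^ k.
  by apply: (ge0_ler_powR (ltW k_gt0)); rewrite ?nnegrE ?(ltW (v_gt0 _))// v_ndecr.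
rewrite ler_pdivrMr//.
have -> : 4 * (v z `^ k / z ^+ 2 * (2 * s - s)) * s =
    v z `^ k * ((2 * s) ^+ 2 / z ^+ 2).
  by field; rewrite gt_eqF.
apply: (le_trans h1); rewrite ler_peMr ?powR_ge0//.
by rewrite ler_pdivlMr ?exprn_gt0// mul1r lerXn2r// nnegrE; lra.
Qed.

(** The quotient is the product of (v^k / (s (N - w)))^(alpha - 1), the inverse of the quotient in
    [v_asymptotics], and w^(1 - alpha). The first factor tends to 0, the others to 1/k and N^(1 -
    alpha). *)
Lemma P_div_tail :
  P s / s `^ (alpha - 2) / (N - w s) `^ (alpha - 1) @[s --> +oo] --> (0 : R).
Proof.
have N0 : 0 < N by rewrite (lt_trans (w_gt0 (lexx s0)))// w_lt_lim.
have H1 := cvg0_powRy alpha1_gt0 _ dw_tail.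
have {}H1 : (v s `^ k / (s * (N - w s))) `^ (alpha - 1) @[s --> +oo] --> (0 : R).
  apply: H1; apply: (@near_pinftyS _ s0) => s s0s.
  rewrite divr_ge0 ?powR_ge0// mulr_ge0 ?(ltW (s_gt0 s0s))// subr_ge0 ltW//.
  exact: w_lt_lim.
have Hw := cvg_powRy (k := alpha - 1) N0 w_cvg.
have k0 : k != 0 by rewrite gt_eqF.
have H2 := cvgM H1 (cvgM (cvgV k0 v_asymptotics)
  (cvgV (lt0r_neq0 (powR_gt0 (alpha - 1) N0)) Hw)).
rewrite mul0r in H2.
apply: near_eq_cvgy (H2 _ _ _ _); apply: (@near_pinftyS _ s0) => s s0s.
have Nw := w_lt_lim s0s; have Nw0 : 0 < N - w s by rewrite subr_gt0.
have s'0 := s_gt0 s0s; have ? := w_gt0 s0s; have ? := P_gt0 s0s.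
rewrite /= powR_div ?powR_ge0// ?powRKV ?(ltW (v_gt0 _))//; last first.
  by rewrite mulr_ge0// ltW.
rewrite !powRM ?(ltW s'0) ?(ltW Nw0) ?ltW//.
have ? : 0 < s `^ (alpha - 1) by rewrite powR_gt0.
have ? : 0 < s `^ (alpha - 2) by rewrite powR_gt0.
have ? : 0 < (N - w s) `^ (alpha - 1) by rewrite powR_gt0.
have ? : 0 < w s `^ (alpha - 1) by rewrite powR_gt0.
have ? := v_gt0 s0s.
by field; rewrite !gt_eqF.
Qed.

End finite_limit.

End transformed_equation.

(** * The change of variable *)

Section half_line.
Context {R : realType}.
Notation mu := (@lebesgue_measure R).
Implicit Types (f F : R -> R) (a b x t : R).

Lemma within_itvcy_continuous_at f a t :
  {within `[a, +oo[, continuous f} -> a < t -> {for t, continuous f}.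
Proof.
by move=> /continuous_within_itvcyP[fc _] at0; apply: fc; rewrite in_itv/= andbT.
Qed.

Lemma within_itvcy_powR f a (e : R) : (forall t, a <= t -> 0 < f t) ->
  {within `[a, +oo[, continuous f} ->
  {within `[a, +oo[, continuous (fun t => f t `^ e)}.
Proof.
move=> f0 /continuous_within_itvcyP[fc fa]; apply/continuous_within_itvcyP; split.
  move=> x xa; apply: (@continuous_cvg _ _ _ _ _ _ (fun z => z `^ e));
    last exact: fc.
  apply: is_derive1_continuous (is_derive1_powR e _); apply: f0.
  by move: xa; rewrite in_itv/= andbT => /ltW.
apply: (@continuous_cvg _ _ _ _ _ _ (fun z => z `^ e)) fa.
by apply: is_derive1_continuous (is_derive1_powR e _); exact: f0.
Qed.

Lemma within_itvcyM f g a : {within `[a, +oo[, continuous f} ->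
  {within `[a, +oo[, continuous g} ->
  {within `[a, +oo[, continuous (fun t => f t * g t)}.
Proof.
by move=> fc gc x; apply: cvgM; [exact: fc|exact: gc].
Qed.

Lemma ge0_integrable_itvcy f a : (forall t, a <= t -> 0 <= f t) ->
  {within `[a, +oo[, continuous f} ->
  (\int[mu]_(t in `[a, +oo[) (f t)%:E < +oo)%E ->
  mu.-integrable `[a, +oo[ (EFin \o f).
Proof.
move=> f0 fc fi; apply/integrableP; split.
  by apply/measurable_EFinP; exact: subspace_continuous_measurable_fun.
suff <- : (\int[mu]_(t in `[a, +oo[) (f t)%:E =
    \int[mu]_(t in `[a, +oo[) `|(EFin \o f) t|)%E by [].
apply: eq_integral => t; rewrite inE/= in_itv/= andbT => at0.
by rewrite ger0_norm// f0.
Qed.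

Lemma ndecr_bounded_cvgy f a (M : R) :
  (forall x y, a <= x -> x <= y -> f x <= f y) ->
  (forall x, a <= x -> f x <= M) ->
  exists2 l, f t @[t --> +oo] --> l & forall x, a <= x -> f x <= l.
Proof.
(* Freezing f to the left of a gives a function that is monotone on the whole line and has the same
   limit. *)
move=> fnd fM; pose g x := f (Num.max a x).
have gnd : nondecreasing_fun g.
  move=> x y xy; apply: fnd; first by rewrite le_max lexx.
  by rewrite ge_max !le_max lexx xy orbT.
have gub : has_ubound (range g).
  by exists M => _ [x _ <-]; apply: fM; rewrite le_max lexx.
have fl : f t @[t --> +oo] --> sup (range g).
  apply: near_eq_cvgy (nondecreasing_cvgr gnd gub).
  by apply: (@near_pinftyS _ a) => t at0; rewrite /g max_r.
exists (sup (range g)) => // x ax; apply: (cvgr_to_ge fl).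
by apply: (@near_pinftyS _ x) => t xt; exact: fnd.
Qed.

Lemma is_derive_FTC2y f F a (l : R) : (forall x, a <= x -> 0 <= f x) ->
  (forall x, a <= x -> {for x, continuous f}) ->
  (forall x, a <= x -> is_derive x 1 F (f x)) ->
  F x @[x --> +oo] --> l ->
  (\int[mu]_(x in `[a, +oo[) (f x)%:E = (l - F a)%:E)%E.
Proof.
move=> f0 fc dF Fl; rewrite (@ge0_continuous_FTC2y R f F a l)//.
- apply: continuous_in_subspaceT => x; rewrite inE/= in_itv/= andbT; exact: fc.
- by move=> x ax; have [] := dF x (ltW ax).
- by apply: cvg_at_right_filter; exact: is_derive1_continuous (dF a (lexx a)).
- move=> x; rewrite in_itv/= andbT => ax; rewrite derive1E.
  by have [_] := dF x (ltW ax).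
Qed.

End half_line.

(** * Monotonicity, limits and derivatives of [R_C], [Q] and [Qinv] *)

Section change_of_variable.
Context {R : realType}.
Notation mu := (@lebesgue_measure R).
Implicit Types (s t : R).
Variables (a beta : R) (r : R -> R).
Hypotheses (r_cont : {within `[a, +oo[, continuous r})
  (r_gt0 : forall t, a <= t -> 0 < r t)
  (int_r : (\int[mu]_(s in `[a, +oo[) (r s `^ (1 - beta))%:E < +oo)%E).

Let f s := r s `^ (1 - beta).

Let f_gt0 t : a <= t -> 0 < f t.
Proof. by move=> at0; rewrite powR_gt0// r_gt0. Qed.

Let f_within : {within `[a, +oo[, continuous f}.
Proof. exact: within_itvcy_powR. Qed.

Let f_cont t : a < t -> {for t, continuous f}.
Proof. exact: within_itvcy_continuous_at. Qed.

Let f_int : mu.-integrable `[a, +oo[ (EFin \o f).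
Proof. by apply: ge0_integrable_itvcy => // t /f_gt0/ltW. Qed.

Let RC := R_C beta r.
Let q := Q beta r.
Let g := Qinv a beta r.

Let RCE t : a <= t -> RC t = RC a - \int[mu]_(s in `[a, t]) f s.
Proof.
move=> at0.
rewrite [in RHS]/RC /R_C (@Rintegral_itvB _ _ (BLeft a) (BInfty _ false))//.
rewrite Rintegral_itv_obnd_cbnd//; apply: integrableS f_int => //.
by apply: subset_itvr; rewrite bnd_simp.
Qed.

Lemma is_derive_R_C t : a < t -> is_derive t 1 (R_C beta r) (- r t `^ (1 - beta)).
Proof.
move=> at0; have [tt1 iu] : t < t + 1 /\ mu.-integrable `[a, t + 1] (EFin \o f).
  split; first by rewrite ltrDl.
  by apply: integrableS f_int => //; exact: subset_itvl.
have [dF F'] := continuous_FTC1_closed tt1 iu at0 (f_cont at0).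
have h : is_derive t 1 (fun x => RC a - \int[mu]_(s in `[a, x]) f s) (- f t).
  rewrite -sub0r; apply: (is_deriveB (is_derive_cst (RC a) t 1)).
  by apply: (DeriveDef dF); rewrite -derive1E F'.
apply: near_eq_is_derive h; near=> x; rewrite -RCE//.
by apply: ltW; near: x; exact: lt_nbhsr.
Unshelve. all: by end_near. Qed.

Lemma R_C_within : {within `[a, +oo[, continuous (R_C beta r)}.
Proof.
apply/continuous_within_itvcyP; split.
  move=> x; rewrite in_itv/= andbT => ax.
  exact: is_derive1_continuous (is_derive_R_C ax).
have a1 : a < a + 1 by rewrite ltrDl.
have iu : mu.-integrable `[a, a + 1] (EFin \o f).
  by apply: integrableS f_int => //; exact: subset_itvl.
have H : RC a - parameterized_integral mu a x f @[x --> a^'+] --> RC a.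
  rewrite -[X in _ --> X]subr0; apply: cvgB; first exact: cvg_cst.
  by apply: cvg_at_right_filter; exact: parameterized_integral_cvg_left a1 iu.
apply: cvg_trans H; apply: near_eq_cvg; near=> x.
by rewrite /= -RCE//; near: x; exact: nbhs_right_ge.
Unshelve. all: by end_near. Qed.

Let RC_decr s t : a <= s -> s < t -> RC t < RC s.
Proof.
have h x y : a < x -> x < y -> RC y < RC x.
  move=> ax xy; rewrite -ltrN2.
  apply: (@is_derive_gt0_lt R (fun x => - RC x) f x) => // z xz.
    rewrite -[f z]opprK; apply: is_deriveN; apply: is_derive_R_C.
    exact: lt_le_trans xz.
  by apply: f_gt0; rewrite ltW// (lt_le_trans ax).
(* The derivative used in [h] is available only to the right of a. When s = a, strictness comes from
   the interval [u, t], and on [a, u] a weak inequality suffices. *)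
move=> as0 st; pose u := (s + t) / 2.
have su : s < u by rewrite midf_lt. 
have ut : u < t by rewrite midf_lt.
apply: (lt_le_trans (h u t (le_lt_trans as0 su) ut)).
move: as0 su; rewrite le_eqVlt => /predU1P[<- au|as0 su]; last exact/ltW/h.
rewrite (RCE (ltW au)) lerBlDr lerDl; apply: Rintegral_ge0 => x.
by rewrite /= in_itv/= => /andP[/f_gt0/ltW].
Qed.

Lemma R_C_gt0 t : a <= t -> 0 < R_C beta r t.
Proof.
move=> at0; have tt1 : t < t + 1 by rewrite ltrDl.
apply: le_lt_trans (RC_decr at0 tt1); apply: Rintegral_ge0 => x.
rewrite /= in_itv/= andbT => h.
by rewrite ltW// f_gt0// (le_trans at0)// (le_trans (ltW tt1)).
Qed.

(** The bounded monotone function -R_C has a limit l. The fundamental theorem evaluates the integral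
    over [a + 1, +oo) as l + R_C(a + 1), but this integral is R_C(a + 1) by definition, so l = 0. *)
Lemma R_C_cvg0 : R_C beta r t @[t --> +oo] --> (0 : R).
Proof.
have a1 : a < a + 1 by rewrite ltrDl.
have [x y ax|x ax|l ll _] := @ndecr_bounded_cvgy R (fun t => - RC t) (a + 1) 0.
- rewrite le_eqVlt => /predU1P[->//|xy].
  by rewrite lerN2 ltW// RC_decr// (le_trans (ltW a1)).
- by rewrite oppr_le0 ltW// R_C_gt0// (le_trans (ltW a1)).
have : (RC (a + 1))%:E = (l - (- RC (a + 1)))%:E.
  transitivity (\int[mu]_(x in `[(a + 1)%R, +oo[) (f x)%:E)%E; last first.
    apply: (@is_derive_FTC2y R f (fun t => - RC t) (a + 1)) => //.
  - by move=> x ax; rewrite ltW// f_gt0// (le_trans (ltW a1)).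
  - by move=> x ax; apply: f_cont; exact: lt_le_trans ax.
  - move=> x ax; rewrite -[f x]opprK; apply: is_deriveN; apply: is_derive_R_C.
    exact: lt_le_trans ax.
  rewrite /RC /R_C /Rintegral fineK//.
  apply: integrable_fin_num => //; apply: integrableS f_int => //.
  by apply: subset_itvr; rewrite bnd_simp ltW.
rewrite opprK => -[] /eqP; rewrite eq_sym -subr_eq0 addrK => /eqP l0.
move: ll; rewrite l0 => /cvgN; rewrite oppr0.
by apply: near_eq_cvgy; apply: nearW => t /=; rewrite opprK.
Qed.

Lemma Q_gt0 t : a <= t -> 0 < Q beta r t.
Proof. by move=> at0; rewrite invr_gt0 R_C_gt0. Qed.

Lemma Q_lt s t : a <= s -> s < t -> Q beta r s < Q beta r t.
Proof.
move=> as0 st; have at0 := le_trans as0 (ltW st).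
by rewrite ltf_pV2 ?posrE ?R_C_gt0// RC_decr.
Qed.

Lemma Q_le s t : a <= s -> s <= t -> Q beta r s <= Q beta r t.
Proof. by move=> as0; rewrite le_eqVlt => /predU1P[->//|/(Q_lt as0)/ltW]. Qed.

Lemma Q_cvgy : Q beta r t @[t --> +oo] --> +oo.
Proof.
apply/gtr0_cvgV0; first by apply: (@near_pinftyS _ a) => t; exact: Q_gt0.
apply: near_eq_cvgy R_C_cvg0; apply: nearW => t.
by rewrite /= /Q invrK.
Qed.

Lemma is_derive_Q t : a < t ->
  is_derive t 1 (Q beta r) (r t `^ (1 - beta) / R_C beta r t ^+ 2).
Proof.
move=> at0; have RC0 : R_C beta r t != 0 by rewrite gt_eqF// R_C_gt0// ltW.
have := is_deriveV RC0 (is_derive_R_C at0).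
by rewrite /GRing.scale/= mulrNN mulrC.
Qed.

Lemma QK t : a <= t -> Qinv a beta r (Q beta r t) = t.
Proof.
move=> at0; apply: pinvKV; last by rewrite inE/= in_itv/= andbT.
move=> x y; rewrite !inE/= !in_itv/= !andbT => ax ay xy; apply/eqP.
by case: ltgtP => // h; [have := Q_lt ax h|have := Q_lt ay h]; rewrite xy ltxx.
Qed.

(** As Q is continuous and tends to infinity, the intermediate value theorem puts s in its image,
    where [pinv] is a true inverse. The strict a < t keeps the preimage in the open half-line, on
    which Q is differentiable. *)
Lemma QinvK t s : a < t -> Q beta r t <= s ->
  t <= Qinv a beta r s /\ Q beta r (Qinv a beta r s) = s.
Proof.
move=> at0 ts.
have [u tu su] := near_pinftyP ((cvgryPge _).1 Q_cvgy s) t.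
have cQ : {within `[t, u], continuous (Q beta r)}.
  apply: within_continuous_at => x /andP[tx _].
  by apply: is_derive1_continuous (is_derive_Q _); exact: lt_le_trans tx.
have [|x xtu xs] := IVT tu cQ (v := s).
  rewrite min_l ?max_r ?ts ?su//; apply: Q_le => //; exact: ltW.
move: xtu; rewrite in_itv/= => /andP[tx _].
by rewrite -xs QK// (le_trans (ltW at0)).
Qed.

Lemma Qinv_cvgy : Qinv a beta r s @[s --> +oo] --> +oo.
Proof.
apply/cvgryPge => A; pose t := Num.max A (a + 1).
have at0 : a < t by rewrite lt_max ltrDl ltr01 orbT.
apply: (@near_pinftyS _ (Q beta r t)) => s /(QinvK at0)[h _].
by rewrite (le_trans _ h)// le_max lexx.
Qed.

Lemma is_derive_Qinv t s : a < t -> Q beta r t <= s ->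
  is_derive s 1 (Qinv a beta r)
    (R_C beta r (Qinv a beta r s) ^+ 2 * r (Qinv a beta r s) `^ (beta - 1)).
Proof.
move=> at0 ts; have [tg gs] := QinvK at0 ts.
have ag : a < Qinv a beta r s := lt_le_trans at0 tg.
have rg := r_gt0 (ltW ag); have RCg := R_C_gt0 (ltW ag).
rewrite -{1}gs.
have -> : R_C beta r (Qinv a beta r s) ^+ 2 * r (Qinv a beta r s) `^ (beta - 1)
  = (r (Qinv a beta r s) `^ (1 - beta) / R_C beta r (Qinv a beta r s) ^+ 2)^-1.
  by rewrite invf_div; congr (_ * _); rewrite -powRN opprB.
apply: is_derive_inverse.
- near=> x; apply: QK; apply: ltW; near: x; exact: lt_nbhsr.
- near=> x; apply: is_derive1_continuous (is_derive_Q _).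
  by near: x; exact: lt_nbhsr.
- exact: is_derive_Q.
- by rewrite mulf_neq0// ?invr_eq0 ?expf_neq0// gt_eqF// powR_gt0.
Unshelve. all: by end_near. Qed.

End change_of_variable.

(** * Solutions of the original equation *)

Lemma is_derive_within {R : realType} (f : R -> R) (t0 t : R) : t0 < t ->
  derivable_within `[t0, +oo[ f t ->
  is_derive t 1 f (derive_within `[t0, +oo[ f t).
Proof.
move=> t0t; rewrite /derivable_within /derive_within.
set l := lim _ => fl.
have {}fl : (f z - f t) / (z - t) @[z --> t^'] --> l.
  move=> P /fl; rewrite !nbhs_simpl /within/= => H.
  have t0z : \forall z \near t^', t0 <= z.
    by apply: nbhs_dnbhs; near=> z; apply: ltW; near: z; exact: lt_nbhsr.
  by apply: filterS2 H t0z => z /[swap] t0z; apply; rewrite /= in_itv/= andbT.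
apply/is_derive1_caratheodory.
(* Caratheodory's criterion: the slope function, completed by l at t, is continuous there. *)
exists (fun z => if z == t then l else (f z - f t) / (z - t)); split.
- move=> z; case: eqP => [->|/eqP]; first by rewrite !subrr mulr0.
  by rewrite -subr_eq0 => /divfK->.
- apply/continuous_withinNx; rewrite eqxx; apply: cvg_trans fl.
  apply: near_eq_cvg; near=> z; rewrite ifN//.
  by near: z; exact: nbhs_dnbhs_neq.
- by rewrite eqxx.
Unshelve. all: by end_near. Qed.

Lemma limf_esup_lty {R : realType} (f : R -> R) :
  (limf_esup (fun t => (f t)%:E) (pinfty_nbhs R) < +oo)%E ->
  exists M, \forall t \near +oo, f t <= M.
Proof.
rewrite limf_esupE => /ereal_inf_lt[_ [V VF <-]].
(* If the supremum is -oo then V has no point, and any bound, here 0, will do. *)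
case E : (ereal_sup _) => [M||] // _; [exists M|exists 0].
all: apply: filterS VF => t Vt.
all: have := @ereal_sup_ubound R [set (f t)%:E | t in V] (f t)%:E; rewrite E.
all: by move=> /(_ (ex_intro2 _ _ t Vt erefl)).
Qed.

Section increasing_solutions.
Context {R : realType}.
Implicit Types (s t : R).
Variables (a alpha beta : R) (r p tau y : R -> R) (t0 t1 c : R).
Notation mu := (@lebesgue_measure R).
Let k := beta - 1.
Let dy := derive_within `[t0, +oo[ y.
Let y1 := quasi alpha r dy.
Let dy1 := derive_within `[t0, +oo[ y1.
Let g := Qinv a beta r.
Let T := tau_C a beta r tau.
Let P := p_C a beta r p.
Hypotheses (alpha_gt1 : 1 < alpha) (k_conj : (beta - 1) * (alpha - 1) = 1)
  (r_cont : {within `[a, +oo[, continuous r})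
  (r_gt0 : forall t, a <= t -> 0 < r t)
  (p_gt0 : forall t, a <= t -> 0 < p t)
  (int_r : (\int[mu]_(s in `[a, +oo[) (r s `^ (1 - beta))%:E < +oo)%E)
  (pC_RV : RV (alpha - 2) (p_C a beta r p))
  (pC_L : slow_part (alpha - 2) (p_C a beta r p) t @[t --> +oo] --> (0 : R))
  (at0 : a <= t0) (t01 : t0 < t1)
  (y_sol : solution_on alpha r p tau `[t0, +oo[ y)
  (y_gt0 : forall t, t0 <= t -> 0 < y t)
  (dy_gt0 : forall t, t1 <= t -> 0 < dy t)
  (c_gt0 : 0 < c)
  (tau_ge : forall s, Q beta r t1 <= s -> t0 <= tau (g s))
  (T_bounds : \forall s \near +oo, [/\ Q beta r t1 <= T s, T s <= s & c * s <= T s]).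

Let s0 := Q beta r t1.
Let w s := y (g s).
Let v s := y1 (g s).
Let dg s := R_C beta r (g s) ^+ 2 * r (g s) `^ k.
Let dv s := dy1 (g s) * dg s.

Let at1 : a < t1. Proof. exact: le_lt_trans at0 t01. Qed.

Let s0_gt0 : 0 < s0. Proof. by apply: (Q_gt0 r_cont r_gt0 int_r); exact: ltW. Qed.

Let g_ge s : s0 <= s -> t1 <= g s.
Proof. by move=> /(QinvK r_cont r_gt0 int_r at1)[]. Qed.

Let gK s : s0 <= s -> Q beta r (g s) = s.
Proof. by move=> /(QinvK r_cont r_gt0 int_r at1)[]. Qed.

Let g_derive s : s0 <= s -> is_derive s 1 g (dg s).
Proof. exact: is_derive_Qinv. Qed.

Let ty t : t1 <= t -> t0 < t. Proof. exact: lt_le_trans. Qed.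

Let ta t : t1 <= t -> a < t. Proof. exact: lt_le_trans. Qed.

Let y_derive t : t1 <= t -> is_derive t 1 y (dy t).
Proof.
move=> tt1; have [[dyI _] _ _] := y_sol; apply: is_derive_within; first exact: ty.
by apply: dyI; rewrite /= in_itv/= andbT ltW// ty.
Qed.

Let y1_derive t : t1 <= t -> is_derive t 1 y1 (dy1 t).
Proof.
move=> tt1; have [_ [dyI _] _] := y_sol; apply: is_derive_within; first exact: ty.
by apply: dyI; rewrite /= in_itv/= andbT ltW// ty.
Qed.

Let dy1_cont t : t1 <= t -> {for t, continuous dy1}.
Proof.
move=> tt1; have [_ [_ +] _] := y_sol => /within_itvcy_continuous_at; apply.
exact: ty.
Qed.

Let Phi_gt0 (u : R) : 0 < u -> Phi alpha u = u `^ (alpha - 1).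
Proof. by move=> u0; rewrite /Phi gtr0_norm// gtr0_sg// mulr1. Qed.

Let y1E t : t1 <= t -> y1 t = r t * dy t `^ (alpha - 1).
Proof. by move=> tt1; rewrite /y1 /quasi Phi_gt0// dy_gt0. Qed.

Let y1_gt0 t : t1 <= t -> 0 < y1 t.
Proof.
by move=> tt1; rewrite y1E// mulr_gt0 ?powR_gt0 ?dy_gt0// r_gt0// ltW// ta.
Qed.

Let y1_pow t : t1 <= t -> y1 t `^ k = r t `^ k * dy t.
Proof.
move=> tt1; have rt := r_gt0 (ltW (ta tt1)); have dt := dy_gt0 tt1.
rewrite y1E// powRM ?powR_ge0 ?(ltW rt)//; congr (_ * _).
by rewrite -powRrM mulrC k_conj powRr1// ltW.
Qed.

Let r_cont_at t : a < t -> {for t, continuous r}.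
Proof. exact: within_itvcy_continuous_at. Qed.

Let RCg s : s0 <= s -> R_C beta r (g s) = s^-1.
Proof. by move=> s0s; rewrite -[X in X^-1](gK s0s) invrK. Qed.

(** The chain rule gives y' times R_C^2 r^k at g(s). Here r^k y' is the k-th power of the
    quasiderivative and R_C(g(s)) = 1/s, so r disappears from the system. *)
Let w_derive s : s0 <= s -> is_derive s 1 w (v s `^ k / s ^+ 2).
Proof.
move=> s0s; have t1g := g_ge s0s.
have := is_derive1_comp (y_derive t1g) (g_derive s0s).
suff -> : dy (g s) * dg s = v s `^ k / s ^+ 2 by [].
by rewrite /v y1_pow// /dg RCg// exprVn; ring.
Qed.

Let v_derive s : s0 <= s -> is_derive s 1 v (dv s).
Proof.
by move=> s0s; exact: is_derive1_comp (y1_derive (g_ge s0s)) (g_derive s0s).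
Qed.

Let g_cont s : s0 <= s -> {for s, continuous g}.
Proof. by move=> /g_derive; exact: is_derive1_continuous. Qed.

Let dv_cont s : s0 <= s -> {for s, continuous dv}.
Proof.
move=> s0s; have gs := ta (g_ge s0s).
apply: cvgM; first exact: (continuous_comp (g_cont s0s) (dy1_cont (g_ge s0s))).
apply: cvgM.
  have h : {for s, continuous (fun s => R_C beta r (g s))}.
    apply: (continuous_comp (g_cont s0s)).
    exact: is_derive1_continuous (is_derive_R_C r_cont r_gt0 int_r gs).
  by rewrite expr2; under eq_fun do rewrite expr2; exact: cvgM.
apply: (@continuous_comp _ _ _ g (fun u => r u `^ k) s (g_cont s0s)).
apply: (@continuous_comp _ _ _ r (fun u => u `^ k)); first exact: r_cont_at.
by apply: is_derive1_continuous (is_derive1_powR _ _); exact/r_gt0/ltW.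
Qed.

Let w_gt0 s : s0 <= s -> 0 < w s.
Proof. by move=> s0s; apply: y_gt0; exact: ltW (ty (g_ge s0s)). Qed.

Let v_gt0 s : s0 <= s -> 0 < v s.
Proof. by move=> s0s; apply: y1_gt0; exact: g_ge. Qed.

Let P_gt0 s : s0 <= s -> 0 < P s.
Proof.
move=> s0s; have gs := ltW (ta (g_ge s0s)).
rewrite /P /p_C /= !mulr_gt0 ?powR_gt0 ?r_gt0 ?p_gt0// ?exprn_gt0//.
all: exact: (R_C_gt0 r_cont r_gt0 int_r).
Qed.

Let wT s : s0 <= s -> w (T s) = y (tau (g s)).
Proof.
move=> s0s; rewrite /w /T /tau_C /= /g (QK r_cont r_gt0 int_r)//.
by rewrite (le_trans at0)// tau_ge.
Qed.

Let dvE s : s0 <= s -> dv s = P s * w (T s) `^ (alpha - 1).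
Proof.
move=> s0s; have gs := g_ge s0s.
have [_ _ eqn] := y_sol.
rewrite /dv /dy1 eqn; last by rewrite /= in_itv/= andbT ltW// ty.
rewrite wT// Phi_gt0 ?y_gt0 ?tau_ge// /P /p_C /= /dg -/g; ring.
Qed.

Let dv_gt0 s : s0 <= s -> 0 < dv s.
Proof.
by move=> s0s; rewrite dvE// mulr_gt0 ?P_gt0// powR_gt0// wT// y_gt0// tau_ge.
Qed.

Let P_rv l : 0 < l -> P (l * s) / P s @[s --> +oo] --> l `^ (alpha - 2).
Proof. by case: pC_RV => _; exact. Qed.

Let sQ t : t1 <= t -> s0 <= Q beta r t.
Proof. by move=> tt1; apply: (Q_le r_cont r_gt0 int_r) => //; exact: ltW. Qed.

Let gQ t : t1 <= t -> g (Q beta r t) = t.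
Proof. by move=> tt1; apply: (QK r_cont r_gt0 int_r); exact: ltW (ta tt1). Qed.

(** With psi = s w'/w, which tends to 0, the function ln w is a primitive of psi/s; the constant is
    the value of w at [s0]. *)
Lemma solution_NSV : NSV (y \o Qinv a beta r).
Proof.
pose psi s := v s `^ k / (s * w s).
have psi_cont s : s0 <= s -> {for s, continuous psi}.
  move=> s0s; apply: cvgM.
    apply: (@continuous_comp _ _ _ v (fun u => u `^ k)).
      exact: is_derive1_continuous (v_derive s0s).
    exact: is_derive1_continuous (is_derive1_powR _ (v_gt0 s0s)).
  apply: cvgV; first by rewrite mulf_neq0// gt_eqF ?w_gt0// (lt_le_trans s0_gt0).
  by apply: cvgM; [exact: cvg_id|exact: is_derive1_continuous (w_derive s0s)].
exists (w s0), s0, psi; split.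
- exact: w_gt0.
- exact: s0_gt0.
- apply: subspace_continuous_measurable_fun => //.
  apply: continuous_in_subspaceT => x; rewrite inE/= in_itv/= andbT; exact: psi_cont.
- exact: (v_div_sw alpha_gt1 k_conj s0_gt0 w_derive v_derive w_gt0 v_gt0 dvE P_gt0
    T_bounds pC_L).
apply: (@near_pinftyS _ s0) => s s0s.
have q_cont x : s0 <= x <= s -> {for x, continuous (fun s => psi s / s)}.
  move=> /andP[s0x _]; apply: cvgM; first exact: psi_cont.
  by apply: cvgV; [rewrite gt_eqF// (lt_le_trans s0_gt0)|exact: cvg_id].
split.
  apply: continuous_compact_integrable; first exact: segment_compact.
  exact: within_continuous_at.
have -> : \int[mu]_(u in `[s0, s]) (psi u / u) = ln (w s) - ln (w s0); last first.
  by rewrite expRB !lnK ?posrE ?w_gt0// mulrC divfK// gt_eqF// w_gt0.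
apply: (@Rintegral_is_derive R (fun s => psi s / s) (fun s => ln (w s)) s0 s) => //.
move=> x /andP[s0x _].
have := is_derive1_comp (is_derive1_ln (w_gt0 s0x)) (w_derive s0x).
suff -> : (w x)^-1 * (v x `^ k / x ^+ 2) = psi x / x by [].
have ? := w_gt0 s0x; have ? := lt_le_trans s0_gt0 s0x.
by rewrite /psi; field; rewrite !gt_eqF.
Qed.

Lemma solution_quasi_cvgy : quasi alpha r dy t @[t --> +oo] --> +oo.
Proof.
have H := v_cvgy alpha_gt1 k_conj c_gt0 s0_gt0 w_derive v_derive w_gt0 v_gt0 dv_gt0
  dvE P_gt0 T_bounds P_rv pC_L.
have := cvg_comp _ _ (Q_cvgy r_cont r_gt0 int_r) H.
apply: cvg_trans; apply: near_eq_cvg; apply: (@near_pinftyS _ t1) => t tt1.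
by rewrite /= /v gQ.
Qed.
Lemma solution_log_derivative : exists2 eps : R -> R,
  eps t @[t --> +oo] --> (0 : R) &
  forall t, t1 <= t -> q_C_perturbed beta r p eps t = dy t / y t.
Proof.
have H := v_asymptotics alpha_gt1 k_conj c_gt0 s0_gt0 w_derive v_derive dv_cont w_gt0
  v_gt0 dv_gt0 dvE P_gt0 T_bounds P_rv pC_L.
pose h s := v s / ((s * w s) `^ (alpha - 1) * (P s / s `^ (alpha - 2))).
have a1 := alpha_gt1.
have k_gt0 : 0 < k.
  have : 0 < k * (alpha - 1) by rewrite k_conj.
  by rewrite pmulr_lgt0// subr_gt0.
have {}H : h (Q beta r t) @[t --> +oo] --> k.
  exact: cvg_comp _ _ (Q_cvgy r_cont r_gt0 int_r) H.
(* This choice makes the identity exact: (1 + eps) k^k q_C is the k-th power of h(Q(t)) R_C p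
   r^(beta - 2), which equals y^[1] / (y^(alpha - 1) r) by [hE], and that power is y'/y. As h tends
   to k, eps tends to 0. *)
exists (fun t => (h (Q beta r t) / k) `^ k - 1).
  rewrite -(subrr (1 : R)); apply: cvgB; last exact: cvg_cst.
  have one_pow : (1 : R) `^ k = 1 by rewrite powR1.
  rewrite -[X in _ --> X]one_pow.
  apply: (@cvg_powRy _ (fun t => h (Q beta r t) / k) 1 k ltr01).
  by rewrite -(divff (lt0r_neq0 k_gt0)); apply: cvgM H _; exact: cvg_cst.
move=> t tt1; rewrite /q_C_perturbed addrC subrK -/k.
have rt := r_gt0 (ltW (ta tt1)); have pt := p_gt0 (ltW (ta tt1)).
have yt : 0 < y t by apply: y_gt0; exact/ltW/ty.
have y1t := y1_gt0 tt1.
have Rt : 0 < R_C beta r t by apply: (R_C_gt0 r_cont r_gt0 int_r); exact/ltW/ta.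
have st := lt_le_trans s0_gt0 (sQ tt1).
have hE : h (Q beta r t) * (R_C beta r t * p t * r t `^ (beta - 2)) =
    y1 t / (y t `^ (alpha - 1) * r t).
  rewrite /h /v /w gQ// /P /p_C /= -/g gQ//.
  have -> : beta - 2 = k - 1 by rewrite /k; ring.
  have -> : alpha - 2 = alpha - 1 - 1 by ring.
  rewrite (@powR_sub1 _ (r t) k)// (@powR_sub1 _ (Q beta r t))//.
  rewrite powRM ?(ltW st) ?(ltW yt)// -/k.
  have A0 : 0 < Q beta r t `^ (alpha - 1) by rewrite powR_gt0.
  have B0 : 0 < y t `^ (alpha - 1) by rewrite powR_gt0.
  have K0 : 0 < r t `^ k by rewrite powR_gt0.
  move: (Q beta r t `^ (alpha - 1)) A0 => A A0.
  by rewrite /Q; field; rewrite !gt_eqF.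
have q0 : 0 <= R_C beta r t * p t * r t `^ (beta - 2).
  by rewrite ltW// !mulr_gt0// powR_gt0.
have h0 : 0 < h (Q beta r t).
  apply: divr_gt0; first exact: v_gt0 (sQ tt1).
  apply: mulr_gt0; first by rewrite powR_gt0// mulr_gt0// w_gt0// sQ.
  by apply: divr_gt0; [exact: P_gt0 (sQ tt1)|rewrite powR_gt0].
rewrite powRM ?(ltW h0) ?invr_ge0 ?(ltW k_gt0)//.
rewrite powR_invr ?(ltW k_gt0)// divfK ?gt_eqF ?powR_gt0//.
rewrite /q_C -/k -powRM ?(ltW h0)// hE.
have B0 : 0 < y t `^ (alpha - 1) by rewrite powR_gt0.
rewrite powRM ?(ltW y1t) ?invr_ge0 ?mulr_ge0 ?(ltW B0) ?(ltW rt)//.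
rewrite powR_invr ?mulr_ge0 ?(ltW B0) ?(ltW rt)//.
rewrite powRM ?(ltW B0) ?(ltW rt)// y1_pow//.
rewrite -powRrM [(alpha - 1) * k]mulrC k_conj powRr1 ?(ltW yt)//.
have ? : 0 < r t `^ k by rewrite powR_gt0.
by field; rewrite !gt_eqF.
Qed.

Lemma solution_finite_limit (N : R) : y t @[t --> +oo] --> N ->
  SV (fun s => `|y (Qinv a beta r s) - N|) /\
  R_C beta r t `^ alpha * p t * r t `^ (beta - 1) / Phi alpha (y t - N)
    @[t --> +oo] --> (0 : R).
Proof.
move=> yN.
have wN : w s @[s --> +oo] --> N.
  exact: cvg_comp _ _ (Qinv_cvgy r_cont r_gt0 int_r) yN.
have wlt s : s0 <= s -> w s < N.
  by move=> s0s; exact: (w_lt_lim s0_gt0 w_derive v_gt0 wN s0s).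
have absE s : s0 <= s -> `|y (Qinv a beta r s) - N| = N - w s.
  by move=> s0s; rewrite distrC gtr0_norm// subr_gt0; exact: wlt.
split; first split.
- exists s0; split; last by move=> s s0s; rewrite absE// subr_gt0 wlt.
  apply: subspace_continuous_measurable_fun => //.
  apply: continuous_in_subspaceT => x; rewrite inE/= in_itv/= andbT => s0x.
  apply: cvg_norm; apply: cvgB; last exact: cvg_cst.
  exact: is_derive1_continuous (w_derive s0x).
- move=> l l0; rewrite powRr0.
  have H := tail_sv alpha_gt1 k_conj c_gt0 s0_gt0 w_derive v_derive w_gt0
    v_gt0 dv_gt0 dvE P_gt0 T_bounds P_rv pC_L wN l0.
  apply: near_eq_cvgy H; near=> s.
  have s0s : s0 <= s by near: s; apply: nbhs_pinfty_ge; rewrite num_real.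
  have s0ls : s0 <= l * s.
    by rewrite mulrC -ler_pdivrMr.
  by rewrite !absE.
have H := P_div_tail alpha_gt1 k_conj c_gt0 s0_gt0 w_derive v_derive dv_cont w_gt0
    v_gt0 dv_gt0 dvE P_gt0 T_bounds P_rv pC_L wN.
(* The sign comes from y < N and the oddness of Phi. At s = Q(t) one has R_C^alpha = R_C^2 s^(2 -
   alpha), which turns the numerator into P(s)/s^(alpha - 2). *)
have := cvgN (cvg_comp _ _ (Q_cvgy r_cont r_gt0 int_r) H).
rewrite oppr0 => /(_ _); apply: near_eq_cvgy.
apply: (@near_pinftyS _ t1) => t tt1 /=.
have s0Q := sQ tt1; have st := lt_le_trans s0_gt0 s0Q.
have Nw : y t < N by have := wlt _ s0Q; rewrite /w gQ.
rewrite /Phi ltr0_norm ?subr_lt0// ltr0_sg ?subr_lt0// opprB.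
rewrite /w gQ// /P /p_C /= -/g gQ//.
have -> : R_C beta r t = (Q beta r t)^-1 by rewrite invrK.
rewrite powR_invr ?(ltW st)//.
have -> : Q beta r t `^ alpha = Q beta r t ^+ 2 * Q beta r t `^ (alpha - 2).
  rewrite -powR_mulrn ?(ltW st)// -powRD ?lt0r_neq0 ?implybT//.
  by congr (_ `^ _); ring.
have ? : 0 < Q beta r t `^ (alpha - 2) by rewrite powR_gt0.
have ? : 0 < (N - y t) `^ (alpha - 1) by rewrite powR_gt0// subr_gt0.
by field; rewrite !gt_eqF.
Unshelve. all: by end_near. Qed.

End increasing_solutions.

(** * From the logarithmic derivative to the integral formulas *)

Lemma integrable_setU d (X : measurableType d) (R : realType)
    (mu : {measure set X -> \bar R}) (A B : set X) (f : X -> \bar R) :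
  measurable A -> measurable B -> [disjoint A & B] ->
  mu.-integrable A f -> mu.-integrable B f -> mu.-integrable (A `|` B) f.
Proof.
move=> mA mB AB /integrableP[mfA fA] /integrableP[mfB fB].
have mf : measurable_fun (A `|` B) f by apply/measurable_funU.
apply/integrableP; split => //.
rewrite ge0_integral_setU//; last exact: measurableT_comp.
exact: lte_add_pinfty.
Qed.

(** * Integrals of (1 + eps) C q, applied with q = q_C, C = (beta - 1)^(beta - 1), l = ln y and dl =
    y'/y *)

Section perturbed_integrals.
Context {R : realType}.
Notation mu := (@lebesgue_measure R).
Implicit Types (s t : R).
Variables (a t1 C : R) (q eps l dl : R -> R).
Hypotheses (at1 : a < t1) (C_gt0 : 0 < C)
  (q_cont : {within `[a, +oo[, continuous q})
  (q_gt0 : forall t, a <= t -> 0 < q t)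
  (eps_cvg0 : eps t @[t --> +oo] --> (0 : R))
  (epsE : forall t, t1 <= t -> (1 + eps t) * C * q t = dl t)
  (dl_gt0 : forall t, t1 <= t -> 0 < dl t)
  (dl_cont : forall t, t1 <= t -> {for t, continuous dl})
  (l_derive : forall t, t1 <= t -> is_derive t 1 l (dl t)).

Let l_ndecr s t : t1 <= s -> s <= t -> l s <= l t.
Proof. by apply: (is_derive_ge0_le l_derive) => z /dl_gt0/ltW. Qed.

Let q_integrable b : mu.-integrable `[a, b] (EFin \o q).
Proof.
apply: continuous_compact_integrable; first exact: segment_compact.
by apply: continuous_subspaceW q_cont; exact: subset_itvl.
Qed.

Let q_measurable : measurable_fun `[a, +oo[ q.
Proof. exact: subspace_continuous_measurable_fun. Qed.

(* On [a, t1) the perturbation is chosen so that the integrand is constant with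
   integral [l t1]. *)
Lemma exists_eps_integral_eq : exists2 eps' : R -> R,
  eps' t @[t --> +oo] --> (0 : R) &
  forall t, t1 <= t ->
    mu.-integrable `[a, t] (EFin \o (fun s => (1 + eps' s) * C * q s)) /\
    \int[mu]_(s in `[a, t]) ((1 + eps' s) * C * q s) = l t.
Proof.
pose K := l t1 / (t1 - a).
pose eps' s := if s < t1 then K / (C * q s) - 1 else eps s.
exists eps'.
  apply: near_eq_cvgy eps_cvg0; apply: (@near_pinftyS _ t1) => s.
  by rewrite /eps' ltNge => ->.
move=> t t1t; pose F s := (1 + eps' s) * C * q s.
have F1 s : a <= s -> s < t1 -> F s = K.
  move=> as0 st1; have ? := q_gt0 as0.
  by rewrite /F /eps' st1; field; rewrite !gt_eqF.
have F2 s : t1 <= s -> F s = dl s.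
  by move=> t1s; rewrite /F /eps' ltNge t1s/= epsE.
have cK (x : R) : {for x, continuous (cst K : R -> R)} by exact: cst_continuous.
have iK : mu.-integrable `[a, t1[ (EFin \o cst K).
  apply: (@integrableS _ _ _ mu `[a, t1]) => //; first exact: subset_itv_co_cc.
  apply: continuous_compact_integrable; first exact: segment_compact.
  exact: within_continuous_at.
have iF1 : mu.-integrable `[a, t1[ (EFin \o F).
  apply: eq_integrable iK => // s /[!inE]/= /[!in_itv]/= /andP[as0 st1].
  by rewrite /= F1.
have idl : mu.-integrable `[t1, t] (EFin \o dl).
  apply: continuous_compact_integrable; first exact: segment_compact.
  by apply: within_continuous_at => s /andP[? _]; exact: dl_cont.
have iF2 : mu.-integrable `[t1, t] (EFin \o F).
  apply: eq_integrable idl => // s /[!inE]/= /[!in_itv]/= /andP[t1s _].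
  by rewrite /= F2.
have E : `[a, t]%classic = `[a, t1[%classic `|` `[t1, t]%classic.
  by rewrite -itv_bndbnd_setU// bnd_simp// ltW.
have D : [disjoint `[a, t1[%classic & `[t1, t]%classic].
  apply/disj_setPS => s [/=]; rewrite !in_itv/= => /andP[_ st1] /andP[].
  by rewrite leNgt st1.
have iF : mu.-integrable `[a, t] (EFin \o F) by rewrite E; exact: integrable_setU.
split => //; rewrite E Rintegral_setU -?E//.
rewrite (@eq_Rintegral _ _ _ _ _ (cst K)); last first.
  by move=> s /[!inE]/= /[!in_itv]/= /andP[? ?]; exact: F1.
rewrite Rintegral_itv_bndo_bndc//.
have -> : \int[mu]_(x in `[t1, t]) F x = \int[mu]_(x in `[t1, t]) dl x.
  apply: eq_Rintegral => s; rewrite inE/= in_itv/= => /andP[? _]; exact: F2.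
have -> : \int[mu]_(x in `[a, t1]) cst K x = K * t1 - K * a.
  by apply: (@Rintegral_is_derive R (cst K) (fun x => K * x)) => // *;
    [exact: ltW|exact: is_derive_mull].
have -> : \int[mu]_(x in `[t1, t]) dl x = l t - l t1.
  by apply: Rintegral_is_derive => // x /andP[? _]; [exact: l_derive|exact: dl_cont].
by rewrite /K; field; rewrite subr_eq0 gt_eqF.
Qed.

Lemma tail_integral (L t : R) : t1 <= t -> l s @[s --> +oo] --> L ->
  mu.-integrable `[t, +oo[ (EFin \o (fun s => (1 + eps s) * C * q s)) /\
  \int[mu]_(s in `[t, +oo[) ((1 + eps s) * C * q s) = L - l t.
Proof.
move=> t1t lL.
have H : (\int[mu]_(x in `[t, +oo[) (dl x)%:E = (L - l t)%:E)%E.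
  apply: is_derive_FTC2y => // x tx; have t1x := le_trans t1t tx.
  - exact/ltW/dl_gt0.
  - exact: dl_cont.
  - exact: l_derive.
have cdl : {within `[t, +oo[, continuous dl}.
  apply: continuous_in_subspaceT => x; rewrite inE/= in_itv/= andbT => tx.
  by apply: dl_cont; exact: le_trans tx.
have E : {in `[t, +oo[%classic, dl =1 (fun s => (1 + eps s) * C * q s)}.
  move=> x; rewrite inE/= in_itv/= andbT => tx; rewrite epsE//.
  exact: le_trans tx.
have idl : mu.-integrable `[t, +oo[ (EFin \o dl).
  apply: ge0_integrable_itvcy => // [x tx|]; last by rewrite H ltry.
  by rewrite ltW// dl_gt0// (le_trans t1t).
split; first by apply: eq_integrable idl => // x /E /= ->.
transitivity (\int[mu]_(s in `[t, +oo[) dl s); last by rewrite /Rintegral H.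
by apply: eq_Rintegral => x /E.
Qed.

(** Once eps <= 1, the derivative of l is at most 2 C q, so the increasing function l is bounded. *)
Lemma integral_lty_cvg : (\int[mu]_(s in `[a, +oo[) (q s)%:E < +oo)%E ->
  exists L : R, l t @[t --> +oo] --> L.
Proof.
move=> qfin.
have qi : mu.-integrable `[a, +oo[ (EFin \o q).
  by apply: ge0_integrable_itvcy => // t /q_gt0/ltW.
have /cvgr_le/(_ 1 ltr01)/near_pinftyP/(_ t1)[t2 t12 eps1] := eps_cvg0.
pose M := \int[mu]_(s in `[a, +oo[) q s.
have [//||L lL _] := @ndecr_bounded_cvgy R l t2 (l t2 + 2 * C * M).
- by move=> x y t2x; apply: l_ndecr; exact: le_trans t2x.
- move=> x t2x; rewrite -lerBlDl.
  have <- : \int[mu]_(s in `[t2, x]) dl s = l x - l t2.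
    apply: Rintegral_is_derive => // z /andP[t2z _].
      by apply: l_derive; exact: le_trans t2z.
    by apply: dl_cont; exact: le_trans t2z.
  have at2 : a <= t2 := le_trans (ltW at1) t12.
  have qi' : mu.-integrable `[t2, x] (EFin \o q).
    apply: integrableS qi => //.
    by apply: subset_trans (subset_itvr _) (subset_itvl _); rewrite bnd_simp.
  apply: (@le_trans _ _ (\int[mu]_(s in `[t2, x]) (2 * C * q s))).
    apply: le_Rintegral => //.
    + apply: continuous_compact_integrable; first exact: segment_compact.
      apply: within_continuous_at => z /andP[t2z _].
      by apply: dl_cont; exact: le_trans t2z.
    + exact: (@integrableZl _ _ _ mu _ _ (2 * C) (EFin \o q)).
    + move=> z; rewrite /= in_itv/= => /andP[t2z _].
      rewrite -epsE ?(le_trans t12)// ler_pM2r ?q_gt0 ?(le_trans at2)//.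
      by rewrite ler_pM2r//; have := eps1 _ t2z; lra.
  rewrite RintegralZl// ler_pM2l ?mulr_gt0//.
  rewrite /M /Rintegral fine_le//; [exact: integrable_fin_num..|].
  apply: ge0_subset_integral => //.
  + exact/measurable_EFinP.
  + by move=> z; rewrite /= in_itv/= andbT lee_fin => /q_gt0/ltW.
  + by apply: subset_trans (subset_itvr _) (subset_itvl _); rewrite bnd_simp.
by exists L.
Qed.

(** By contraposition: a bounded l converges, so (1 + eps) C q is integrable at infinity. Once eps
    >= -1/2, q is at most 2/C times this function, hence integrable too. *)
Lemma integral_infinite_cvgy : (\int[mu]_(s in `[a, +oo[) (q s)%:E = +oo)%E ->
  l t @[t --> +oo] --> +oo.
Proof.
move=> qinf.
have [[M lM]|unb] := pselect (exists M, forall t, t1 <= t -> l t <= M); last first.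
  apply/cvgryPge => A; apply: contrapT => nA; apply: unb; exists A => t t1t.
  rewrite leNgt; apply/negP => lt; apply: nA.
  by apply: (@near_pinftyS _ t) => s ts; rewrite (le_trans (ltW lt))// l_ndecr.
have [L lL _] := ndecr_bounded_cvgy l_ndecr lM.
have n12 : - 2^-1 < 0 :> R by lra.
have /cvgr_ge/(_ _ n12)/near_pinftyP/(_ t1)[t2 t12 eps1] := eps_cvg0.
have at2 : a < t2 := lt_le_trans at1 t12.
have [iF _] := tail_integral t12 lL.
suff : (\int[mu]_(s in `[a, +oo[) (q s)%:E < +oo)%E by rewrite qinf ltxx.
have E : `[a, +oo[%classic = `[a, t2[%classic `|` `[t2, +oo[%classic :> set R.
  by rewrite -itv_bndbnd_setU// bnd_simp// ltW.
have D : [disjoint `[a, t2[%classic & (`[t2, +oo[%classic : set R)].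
  apply/disj_setPS => s [/=]; rewrite !in_itv/= => /andP[_ st1] /andP[].
  by rewrite leNgt st1.
have q2 : mu.-integrable `[t2, +oo[ (EFin \o q).
  have iF2 := @integrableZl _ _ _ mu _ (measurable_itv _) (2 / C) _ iF.
  apply: le_integrable iF2 => //.
    apply/measurable_EFinP; apply: measurable_funS q_measurable => //.
    by apply: subset_itvr; rewrite bnd_simp ltW.
  move=> s /=; rewrite in_itv/= andbT => t2s; rewrite lee_fin.
  have qs := q_gt0 (le_trans (ltW at2) t2s).
  rewrite (gtr0_norm qs); apply: le_trans (ler_norm _).
  have -> : 2 / C * ((1 + eps s) * C * q s) = (2 * (1 + eps s)) * q s.
    by field; rewrite gt_eqF.
  by rewrite ler_peMl ?(ltW qs)//; have := eps1 _ t2s; lra.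
have q1 : mu.-integrable `[a, t2[ (EFin \o q).
  by apply: integrableS (q_integrable t2) => //; exact: subset_itv_co_cc.
have qi : mu.-integrable `[a, +oo[ (EFin \o q) by rewrite E; exact: integrable_setU.
have : (\int[mu]_(s in `[a, +oo[) (EFin \o q) s)%E \is a fin_num.
  exact: integrable_fin_num.
by rewrite fin_numElt => /andP[].
Qed.

End perturbed_integrals.

Lemma derive_within_derive1 {R : realType} (f : R -> R) (t0 t : R) : t0 < t ->
  derivable_within `[t0, +oo[ f t -> derive_within `[t0, +oo[ f t = derive1 f t.
Proof. by move=> t0t ft; rewrite derive1E; have [_ ->] := is_derive_within t0t ft. Qed.

Theorem theorem3p7 (R : realType) (a alpha beta : R) (r p tau : R -> R)
  (a_gt0 : 0 < a)
  (alpha_gt1 : 1 < alpha)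
  (conj_ab : alpha^-1 + beta^-1 = 1)
  (r_cont : {within `[a, +oo[, continuous r})
  (r_gt0 : forall t, a <= t -> 0 < r t)
  (p_cont : {within `[a, +oo[, continuous p})
  (p_gt0 : forall t, a <= t -> 0 < p t)
  (int_r : (\int[lebesgue_measure]_(s in `[a, +oo[) (r s `^ (1 - beta))%:E < +oo)%E)
  (pC_RV : RV (alpha - 2) (p_C a beta r p))
  (pC_L : slow_part (alpha - 2) (p_C a beta r p) t @[t --> +oo] --> (0 : R))
  (tau_C1 : C1_on `[a, +oo[ tau)
  (dtau_gt0 : forall t, a <= t -> 0 < derive_within `[a, +oo[ tau t)
  (tau_le : forall t, a <= t -> tau t <= t)
  (tau_ge : \forall t \near +oo, a <= tau t)
  (tauC_limsup :
    (limf_esup (fun t : R => (t / tau_C a beta r tau t)%:E) (pinfty_nbhs R)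
       < +oo)%E)
  (dtauC_SV : SV (derive1 (tau_C a beta r tau)))
  (dtauC_limsup :
    (limf_esup (fun t : R => (derive1 (tau_C a beta r tau) t)%:E) (pinfty_nbhs R)
       < +oo)%E)
  (y : R -> R) (y_IS : classIS a alpha r p tau y) :
  [/\ NSV (y \o Qinv a beta r),
      (\int[lebesgue_measure]_(s in `[a, +oo[) (q_C beta r p s)%:E = +oo)%E ->
        (exists eps : R -> R,
          eps s @[s --> +oo] --> (0 : R) /\
          \forall t \near +oo,
            lebesgue_measure.-integrable `[a, t] (EFin \o q_C_perturbed beta r p eps) /\
            y t = expR (\int[lebesgue_measure]_(s in `[a, t]) q_C_perturbed beta r p eps s))
        /\ classISuv LimInfty LimInfty a alpha r p tau y &
      (\int[lebesgue_measure]_(s in `[a, +oo[) (q_C beta r p s)%:E < +oo)%E ->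
        classISuv LimB LimInfty a alpha r p tau y /\
        exists N : R,
          [/\ 0 < N,
              y t @[t --> +oo] --> N,
              exists eps : R -> R,
                eps s @[s --> +oo] --> (0 : R) /\
                \forall t \near +oo,
                  lebesgue_measure.-integrable `[t, +oo[
                    (EFin \o q_C_perturbed beta r p eps) /\
                  y t = N * expR
                    (- \int[lebesgue_measure]_(s in `[t, +oo[) q_C_perturbed beta r p eps s),
              SV (fun s => `|y (Qinv a beta r s) - N|) &
              R_C beta r t `^ alpha * p t * r t `^ (beta - 1)
                / Phi alpha (y t - N) @[t --> +oo] --> (0 : R)]].
Proof.
have k_conj : (beta - 1) * (alpha - 1) = 1.
  have a0 : alpha != 0 by rewrite gt_eqF//; lra.
  have a1 : alpha - 1 != 0 by rewrite gt_eqF//; lra.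
  have -> : beta = alpha / (alpha - 1).
    rewrite -[LHS]invrK -invf_div; congr (_^-1).
    have -> : beta^-1 = 1 - alpha^-1 by rewrite -conj_ab addrC addKr.
    by field.
  by field.
have k_gt0 : 0 < beta - 1.
  have : 0 < (beta - 1) * (alpha - 1) by rewrite k_conj.
  by rewrite pmulr_lgt0// subr_gt0.
have [[t0 [at0 sol y_gt0]] dyp] := y_IS.
have [M HM] := limf_esup_lty tauC_limsup.
(* [t0] may equal a, whereas [QinvK] asks for a point strictly to the right of a. *)
pose u := t0 + 1; have t0u : t0 < u by rewrite ltrDl.
have au : a < u := le_lt_trans at0 t0u.
have [b ub dyb] := near_pinftyP dyp u.
(* Turns s / tau_C(s) <= M into c s <= tau_C(s); the added 1 keeps the denominator positive. *)
pose c := (`|M| + 1)^-1; have c_gt0 : 0 < c by rewrite invr_gt0 ltr_wpDl.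
have tau_g : \forall s \near +oo, a <= tau (Qinv a beta r s).
  exact: (Qinv_cvgy r_cont r_gt0 int_r tau_ge).
have T_near : \forall s \near +oo, [/\ t0 <= tau (Qinv a beta r s),
    tau_C a beta r tau s <= s & c * s <= tau_C a beta r tau s].
  near=> s.
  have ag : a <= tau (Qinv a beta r s) by near: s.
  have us : Q beta r u <= s by near: s; apply: nbhs_pinfty_ge; rewrite num_real.
  have ucs : Q beta r u <= c * s.
    by rewrite mulrC -ler_pdivrMr.
  have [ug Qg] := QinvK r_cont r_gt0 int_r au us.
  have ag' : a <= Qinv a beta r s := le_trans (ltW au) ug.
  have T_gt0 : 0 < tau_C a beta r tau s by exact: (Q_gt0 r_cont r_gt0 int_r ag).
  have cT : c * s <= tau_C a beta r tau s.
    have : s / tau_C a beta r tau s <= M by near: s.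
    rewrite ler_pdivrMr// => sM; rewrite /c mulrC ler_pdivrMr ?ltr_wpDl//.
    rewrite (le_trans sM)// mulrC ler_pM2l//.
    by rewrite (le_trans (ler_norm _))// lerDl.
  split => //; last first.
    by rewrite -[leRHS]Qg; apply: (Q_le r_cont r_gt0 int_r ag); exact: tau_le.
  (* A delayed argument below [t0] would give tau_C(s) < Q(u) <= c s <= tau_C(s). *)
  rewrite leNgt; apply/negP => taut0.
  have := Q_lt r_cont r_gt0 int_r ag (lt_trans taut0 t0u).
  by rewrite ltNge (le_trans ucs cT).
have [S _ HS] := near_pinftyP T_near 0.
(* [t1] comes after S, so that for t >= t1 the delayed argument stays in [t0, +oo), where y is known
   to be positive. *)
have [t1 bt1 St1] := near_pinftyP ((cvgryPge _).1 (Q_cvgy r_cont r_gt0 int_r) S) b.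
have t01 : t0 < t1 by rewrite (lt_le_trans t0u)// (le_trans ub).
have at1 : a < t1 := le_lt_trans at0 t01.
pose dy := derive_within `[t0, +oo[ y.
have dyE t : t1 <= t -> dy t = derive1 y t.
  move=> tt1; have t0t := lt_le_trans t01 tt1; have [[dyI _] _ _] := sol.
  by apply: derive_within_derive1 => //; apply: dyI; rewrite /= in_itv/= andbT ltW.
have dy_gt0 t : t1 <= t -> 0 < dy t.
  by move=> tt1; rewrite dyE// dyb// (le_trans bt1).
have tau_t0 s : Q beta r t1 <= s -> t0 <= tau (Qinv a beta r s).
  by move=> ts; have [] := HS s (le_trans (St1 t1 (lexx _)) ts).
have T_bounds : \forall s \near +oo, [/\ Q beta r t1 <= tau_C a beta r tau s,
    tau_C a beta r tau s <= s & c * s <= tau_C a beta r tau s].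
  near=> s.
  have [_ Ts cT] : [/\ t0 <= tau (Qinv a beta r s),
    tau_C a beta r tau s <= s & c * s <= tau_C a beta r tau s] by near: s.
  by split => //; apply: le_trans cT; rewrite mulrC -ler_pdivrMr.
have quasi_y : quasi alpha r (derive1 y) t @[t --> +oo] --> +oo.
  have := solution_quasi_cvgy alpha_gt1 k_conj r_cont r_gt0 p_gt0 int_r pC_RV
    pC_L at0 t01 sol y_gt0 dy_gt0 c_gt0 tau_t0 T_bounds.
  apply: cvg_trans; apply: near_eq_cvg; apply: (@near_pinftyS _ t1) => t tt1.
  by rewrite /quasi -dyE.
have [eps eps0 epsE] := solution_log_derivative alpha_gt1 k_conj r_cont r_gt0
  p_gt0 int_r pC_RV pC_L at0 t01 sol y_gt0 dy_gt0 c_gt0 tau_t0 T_bounds.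
have C_gt0 : 0 < (beta - 1) `^ (beta - 1) by rewrite powR_gt0.
have q_gt0 t : a <= t -> 0 < q_C beta r p t.
  move=> at'; rewrite powR_gt0// !mulr_gt0 ?powR_gt0 ?p_gt0 ?r_gt0//.
  exact: (R_C_gt0 r_cont r_gt0 int_r).
have q_cont : {within `[a, +oo[, continuous (q_C beta r p)}.
  apply: within_itvcy_powR.
    move=> t at'; rewrite !mulr_gt0 ?powR_gt0 ?p_gt0 ?r_gt0//.
    exact: (R_C_gt0 r_cont r_gt0 int_r).
  apply: within_itvcyM; last exact: within_itvcy_powR.
  by apply: within_itvcyM p_cont; exact: R_C_within.
have ly_gt0 t : t1 <= t -> 0 < y t.
  by move=> tt1; apply: y_gt0; exact: le_trans (ltW t01) tt1.
pose l t := ln (y t); pose dl t := dy t / y t.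
have y_derive t : t1 <= t -> is_derive t 1 y (dy t).
  move=> tt1; have t0t := lt_le_trans t01 tt1; have [[dyI _] _ _] := sol.
  by apply: is_derive_within => //; apply: dyI; rewrite /= in_itv/= andbT ltW.
have dl_gt0 t : t1 <= t -> 0 < dl t.
  by move=> tt1; rewrite divr_gt0 ?dy_gt0 ?ly_gt0.
have dl_cont t : t1 <= t -> {for t, continuous dl}.
  move=> tt1; apply: cvgM.
    have [[_ dyc] _ _] := sol.
    exact: within_itvcy_continuous_at dyc (lt_le_trans t01 tt1).
  apply: cvgV; first by rewrite gt_eqF ?ly_gt0.
  exact: is_derive1_continuous (y_derive t tt1).
have l_derive t : t1 <= t -> is_derive t 1 l (dl t).
  move=> tt1; rewrite /dl mulrC.
  exact: is_derive1_comp (is_derive1_ln (ly_gt0 t tt1)) (y_derive t tt1).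
split.
- exact: (solution_NSV alpha_gt1 k_conj r_cont r_gt0 p_gt0 int_r pC_L at0 t01
    sol y_gt0 dy_gt0 tau_t0 T_bounds).
- move=> qinf; split.
    (* The integral in (i) starts at a, where y need not be a solution; the freedom of eps on a
       bounded interval supplies the initial value ln y(t1). *)
    have [eps' eps'0 eps'E] := exists_eps_integral_eq at1 C_gt0 q_gt0 eps0 epsE
      dl_cont l_derive.
    exists eps'; split => //; apply: (@near_pinftyS _ t1) => t tt1.
    have [iF FE] := eps'E t tt1; split; first exact: iF.
    rewrite -[LHS]lnK ?posrE ?ly_gt0//; congr expR; exact/esym/FE.
  split => //=; apply/cvgryPge => A.
  have /cvgryPge lA := integral_infinite_cvgy at1 C_gt0 q_cont q_gt0 eps0 epsE
    dl_gt0 dl_cont l_derive qinf.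
  near=> t.
  have yt : 0 < y t.
    by apply: ly_gt0; near: t; apply: nbhs_pinfty_ge; rewrite num_real.
  (* Since ln y < y, the divergence of ln y passes to y. *)
  by apply: le_trans (ltW (ln_sublinear yt)); near: t; exact: lA.
- move=> qfin.
  have [L lL] := integral_lty_cvg at1 C_gt0 q_cont q_gt0 eps0 epsE
    dl_gt0 dl_cont l_derive qfin.
  have yN : y t @[t --> +oo] --> expR L.
    have : expR (l t) @[t --> +oo] --> expR L.
      by apply: (@continuous_cvg _ _ _ _ _ _ (@expR R)) lL; exact: continuous_expR.
    apply: near_eq_cvgy; apply: (@near_pinftyS _ t1) => t tt1.
    by rewrite lnK// posrE ly_gt0.
  have [SVN limN] := solution_finite_limit alpha_gt1 k_conj r_cont r_gt0 p_gt0 int_r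
    pC_RV pC_L at0 t01 sol y_gt0 dy_gt0 c_gt0 tau_t0 T_bounds yN.
  split.
    by split => //=; exists (expR L); rewrite gt_eqF ?expR_gt0.
  exists (expR L); split => //; first exact: expR_gt0.
  exists eps; split => //; apply: (@near_pinftyS _ t1) => t tt1.
  have [iF FE] := tail_integral epsE dl_gt0 dl_cont l_derive tt1 lL.
  split; first exact: iF.
  have -> : \int[lebesgue_measure]_(s in `[t, +oo[) q_C_perturbed beta r p eps s
      = L - l t by exact: FE.
  by rewrite opprB expRB mulrC divfK ?gt_eqF ?expR_gt0// lnK// posrE ly_gt0.
Unshelve. all: by end_near. Qed.
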